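(* Let $C,C'$ be cells and $F$ a flat of the Coxeter complex of $(G,V)$ such that $C\preceq C'\preceq F$. Then $$\mathrm{Res}_F^C=\mathrm{Res}_{\langle C'\rangle}^{C}\circ\mathrm{Res}_F^{C'}$$ as morphisms $\mathcal H_F\to\tilde{\mathcal H}_{C,F}$, where $\mathrm{Res}_{\langle C'\rangle}^C$ denotes the extension $\tilde{\mathcal H}_{C',F}\to\tilde{\mathcal H}_{C,F}$ of the restriction morphism $\mathcal H_{\langle C'\rangle}\to\tilde{\mathcal H}_{C,\langle C'\rangle}$.
   Context: Setting. $G$ is a connected complex reductive group, $T\subset G$ a maximal torus, $\mathfrak g=\mathrm{Lie}(G)$, $\mathfrak h_{\mathbf R}=X_*(T)\otimes_{\mathbf Z}\mathbf R$. $V$ is a finite-dimensional representation of $G$, $T'$ a torus acting linearly on $V$ and commuting with $G$ (acting trivially on $\mathfrak g$), $f\colon V\to\mathbf C$ a $G\times T'$-invariant regular function. Coxeter complex. $\mathfrak H$ is the finite set of hyperplanes $\{\alpha=0\}\subset\mathfrak h_{\mathbf R}$, $\alpha$ a nonzero $T$-weight of $V$ or $\mathfrak g$. Flats: intersections of elements of $\mathfrak H$ (including $\mathfrak h_{\mathbf R}$). Cells: connected components of $\bigcap_{H\in\mathfrak H_1}H\setminus\bigcup_{H\in\mathfrak H_2}H$, $\mathfrak H=\mathfrak H_1\sqcup\mathfrak H_2$. $\langle C\rangle$: linear span of $C$, a flat. $C\preceq C'$ iff $C'\subset\overline C$; $C\preceq F$ iff $F\subset\langle C\rangle$. For a flat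 $F$, $V^F$ is the fixed space of $\lambda$ in $V$ and $G^F$ the centralizer of $\lambda$ in $G$, for a cocharacter $\lambda\in F$ on no hyperplane of $\mathfrak H$ not containing $F$; $f_F=f|_{V^F}$. $\mathcal H_F:=H^*_{G^F\times T'}(V^F,\varphi_{f_F}\mathbf Q)$, $\varphi$ the vanishing cycle functor. Euler classes. For $U=V$ or $\mathfrak g$, with $T\times T'$-weight decomposition $U=\bigoplus_{\alpha\in X^*(T\times T')}U_\alpha$, and $C\preceq F$: $\mathrm{Eu}_{U,C,F}=\prod\alpha^{\dim U_\alpha}$ over $\alpha$ whose $T$-component is negative on $C$ and vanishes on $F$. It is an element of $H^*_{G^{\langle C\rangle}\times T'}(\mathrm{pt})\subset H^*_{T\times T'}(\mathrm{pt})$. Localized system. $\tilde{\mathcal H}_{C,F}:=\mathcal H_{\langle C\rangle}[\mathrm{Eu}_{V,C,F}^{-1}]$. Restriction. For $C\preceq F$, let $i_{\langle C\rangle,F}\colon V^{\langle C\rangle}/(G^{\langle C\rangle}\times T')\to V^F/(G^F\times T')$ be induced by inclusions. Then $$\mathrm{Res}_F^C:=\frac{\mathrm{Eu}_{\mathfrak g,C,F}}{\mathrm{Eu}_{V,C,F}}\,i_{\langle C\rangle,F}^*\colon\mathcal H_F\to\tilde{\mathcal H}_{C,F},$$ with $i^*$ the pullback in vanishing cycle cohomology (from $\varphi_{f_F}\to\varphi_{f_F}i_*i^*\to i_*\varphi_{f_{\langle C\rangle}}i^*$). (Equivalently: pullback to $V^{C\le0,F}/(G^{C\le0,F}\times T')$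 followed by pushforward along the vector bundle stack to $V^{\langle C\rangle}/(G^{\langle C\rangle}\times T')$.) Extension. For $C\preceq C'\preceq F$, $\mathrm{Res}_{\langle C'\rangle}^C$ is $H^*_{G^{\langle C'\rangle}\times T'}(\mathrm{pt})$-linear, hence commutes with multiplication by $\mathrm{Eu}_{V,C',F}$ and extends to $\tilde{\mathcal H}_{C',F}\to\tilde{\mathcal H}_{C,F}$ (note $\mathrm{Eu}_{V,C,F}=\mathrm{Eu}_{V,C,\langle C'\rangle}\mathrm{Eu}_{V,C',F}$). *)

(* Defs.v *)
From HB Require Import structures.
From mathcomp Require Import all_boot all_order all_algebra.
From mathcomp Require Import all_classical all_reals all_analysis.
From mathcomp.real_closed Require Import complex.
From mathcomp Require Import ring.

Set Implicit Arguments.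
Unset Strict Implicit.
Unset Printing Implicit Defensive.

Import Order.TTheory GRing.Theory Num.Theory.
Import numFieldNormedType.Exports.
Local Open Scope classical_set_scope.
Local Open Scope ring_scope.
Local Open Scope quotient_scope.

(* R[i], packaged so that it inherits the topology of a numClosedFieldType. *)
Definition Cplx (R : realType) : numClosedFieldType := R[i].

Definition simplex_set (R : realType) (k : nat) : set 'rV[R]_k.+1 :=
  [set t | (forall i, 0 <= t 0 i) /\ \sum_i t 0 i = 1].

Definition simplex (R : realType) (k : nat) := set_type (@simplex_set R k).

Lemma push_subproof (R : realType) (j k : nat) (th : 'I_j.+1 -> 'I_k.+1)
    (t : simplex R j) :
  simplex_set (\row_l \sum_(i | th i == l) val t 0 i).
Proof.
case: t => t /= /set_mem [t0 t1]; split=> [i|].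
  by rewrite mxE sumr_ge0.
under eq_bigr do rewrite mxE.
by rewrite -t1 [RHS](partition_big th predT).
Qed.

(* The affine map of standard simplices given by [th] on vertices. *)
Definition push (R : realType) (j k : nat) (th : 'I_j.+1 -> 'I_k.+1)
    (t : simplex R j) : simplex R k :=
  SigSub (mem_set (push_subproof th t)).

(* Spaces [dom N], with the topology induced by [space N], joined by maps    *)
(* [step N], and a complex function [fct N] on each of them.                 *)
Record tower (R : realType) := Tower {
  space : nat -> topologicalType ;
  step : forall N, space N -> space N.+1 ;
  dom : forall N, set (space N) ;
  fct : forall N, space N -> Cplx R }.
Arguments dom {R} t N.
Arguments step {R t N}.
Arguments fct {R t N}.

(* Simplices of all dimensions in all stages.  Maps are not required to be   *)
(* continuous, nor to land in [dom N]: cochains are only ever tested on the  *)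
(* simplices satisfying [sing] below, the other values being quotiented out. *)
Definition simplices (R : realType) (X : tower R) : Type :=
  {N : nat & {k : nat & simplex R k -> space X N}}.

Definition sx (R : realType) (X : tower R) N k
    (sg : simplex R k -> space X N) : simplices X :=
  existT _ N (existT _ k sg).

Definition sdim (R : realType) (X : tower R) (s : simplices X) : nat :=
  projT1 (projT2 s).

Definition cochain (R : realType) (X : tower R) : Type := simplices X -> rat.
HB.instance Definition _ R (X : tower R) := GRing.Zmodule.on (cochain X).
HB.instance Definition _ R (X : tower R) := Choice.on (cochain X).

Section Cohomology.
Variable R : realType.

Section OneTower.
Variable X : tower R.
Implicit Types (c b : cochain X) (N k : nat).

Definition cobound c : cochain X := fun s =>
  let: existT N (existT k sg) := s in
  match k return (simplex R k -> space X N) -> rat with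
  | 0 => fun=> 0
  | k'.+1 => fun sg =>
      \sum_(i < k'.+2) (-1) ^+ i * c (sx (sg \o push (lift i)))
  end sg.

Definition cup c b : cochain X := fun s =>
  let: existT N (existT k sg) := s in
  \sum_(p < k.+1)
    c (sx (sg \o push (fun j : 'I_p.+1 => inord j : 'I_k.+1))) *
    b (sx (sg \o push (fun j : 'I_(k - p).+1 => inord (p + j)%N : 'I_k.+1))).

Definition cochain1 : cochain X := fun s => (sdim s == 0)%:R.

Definition restr c : cochain X := fun s =>
  let: existT N (existT k sg) := s in c (sx (step \o sg)).

Definition sing N k (U : set (space X N)) (sg : simplex R k -> space X N) :=
  continuous sg /\ range sg `<=` U.

Definition zero_on N (U : set (space X N)) c :=
  forall k (sg : simplex R k -> space X N), sing U sg -> c (sx sg) = 0.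

Definition fct_nbhd N (U : set (space X N)) :=
  (exists2 W, open W & U = dom X N `&` W) /\
  dom X N `&` [set x | fct x = 0] `<=` U.

Definition fct_pos (N : nat) : set (space X N) :=
  [set x | 0 < complex.Re (fct x)].

(* On a space x with function f, the vanishing cycle complex is taken as     *)
(*   phi_f Q = (R Gamma_{Re f <= 0} Q) restricted to f^{-1}(0)               *)
(* (Kashiwara-Schapira, Sheaves on manifolds, Exercise VIII.13; the shift    *)
(* depends on conventions and is omitted), so that                           *)
(*   H^k(x, phi_f Q) = colim_U H^k(U, U n {Re f > 0}; Q),                    *)
(* U ranging over the open neighbourhoods of f^{-1}(0).  For f = 0 this is   *)
(* H^k(x; Q).  For a tower x_0 -> x_1 -> ... , the cohomology is             *)
(*   (+)_k lim_N H^k(x_N, phi_{f_N} Q).                                      *)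
(* Cochains on U are represented by cochains on all of x_N.                  *)
Definition exact_at N c := exists b, exists U : set (space X N),
  [/\ fct_nbhd U, zero_on (U `&` @fct_pos N) b & zero_on U (c - cobound b)].

Definition is_exact c := forall N, exact_at N c.

Definition is_cocycle c :=
  [/\ exists m, forall s, (m <= sdim s)%N -> c s = 0,
      forall N, exists U : set (space X N),
        [/\ fct_nbhd U, zero_on U (cobound c) & zero_on (U `&` @fct_pos N) c]
    & forall N, exact_at N (restr c - c)].

Lemma coboundB c b : cobound (c - b) = cobound c - cobound b.
Proof.
apply/funext => -[N [[|k] sg]]; rewrite !fctE /= ?subr0 //.
rewrite -sumrB.
by apply: eq_bigr => i _; rewrite !fctE mulrBr.
Qed.

Lemma cobound0 : cobound 0 = 0.
Proof. by rewrite -[X in cobound X](subrr 0) coboundB subrr. Qed.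

Lemma restrB c b : restr (c - b) = restr c - restr b.
Proof. by apply/funext => -[N [k sg]]. Qed.

Lemma sing_sub N k (U U' : set (space X N)) (sg : simplex R k -> space X N) :
  U `<=` U' -> sing U sg -> sing U' sg.
Proof. by move=> sUU' [csg sgU]; split=> // x /sgU /sUU'. Qed.

Lemma zero_on_sub N (U U' : set (space X N)) c :
  U `<=` U' -> zero_on U' c -> zero_on U c.
Proof. by move=> sUU' c0 k sg /(sing_sub sUU')/c0. Qed.

Lemma zero_onB N (U : set (space X N)) c b :
  zero_on U c -> zero_on U b -> zero_on U (c - b).
Proof. by move=> c0 b0 k sg sgU; rewrite !fctE c0 // b0 // subrr. Qed.

Lemma zero_on0 N (U : set (space X N)) : zero_on U 0.
Proof. by []. Qed.

Lemma fct_nbhdT N : fct_nbhd (dom X N).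
Proof. by split=> [|x [] //]; exists setT; rewrite ?setIT//; exact: openT. Qed.

Lemma fct_nbhdI N (U U' : set (space X N)) :
  fct_nbhd U -> fct_nbhd U' -> fct_nbhd (U `&` U').
Proof.
move=> [[W oW ->] fU] [[W' oW' ->] fU']; split.
  by exists (W `&` W'); [exact: openI | rewrite setIACA setIid].
by move=> x fx; split; [exact: fU | exact: fU'].
Qed.

Lemma exact_at0 N : exact_at N 0.
Proof.
exists 0, (dom X N); split; [exact: fct_nbhdT|exact: zero_on0|].
by rewrite cobound0 subrr.
Qed.

Lemma exact_atB N c b : exact_at N c -> exact_at N b -> exact_at N (c - b).
Proof.
move=> [c' [U [nU c'0 c0]]] [b' [V [nV b'0 b0]]].
exists (c' - b'), (U `&` V); split; first exact: fct_nbhdI.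
  apply: zero_onB; [apply: zero_on_sub c'0|apply: zero_on_sub b'0].
    by move=> x [[]].
  by move=> x [[]].
have -> : c - b - cobound (c' - b') = (c - cobound c') - (b - cobound b').
  by rewrite coboundB; apply/funext => s; rewrite !fctE; ring.
apply: zero_onB; [apply: zero_on_sub c0|apply: zero_on_sub b0].
  by move=> x [].
by move=> x [].
Qed.

Definition cocycles : {pred cochain X} := [pred c | `[< is_cocycle c >]].

Lemma cocycles_zmod : zmod_closed cocycles.
Proof.
split=> [|c b /asboolP [[m cm] cU cs] /asboolP [[n bn] bU bs]]; apply/asboolP.
  split=> [|N|N]; first by exists 0%N.
    by exists (dom X N); rewrite cobound0; split=> //; exact: fct_nbhdT.
  by rewrite -[X in restr X](subrr 0) restrB subrr subr0; exact: exact_at0.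
split=> [|N|N].
- exists (maxn m n) => s; rewrite geq_max => /andP[ms ns].
  by rewrite !fctE cm // bn // subrr.
- have [U [nU dc c0]] := cU N; have [V [nV db b0]] := bU N.
  exists (U `&` V); split; first exact: fct_nbhdI.
    rewrite coboundB; apply: zero_onB;
      [apply: zero_on_sub dc|apply: zero_on_sub db].
      by move=> x [].
    by move=> x [].
  apply: zero_onB; [apply: zero_on_sub c0|apply: zero_on_sub b0].
    by move=> x [[]].
  by move=> x [[]].
- have -> : restr (c - b) - (c - b) = (restr c - c) - (restr b - b).
    by rewrite restrB; apply/funext => s; rewrite !fctE; ring.
  exact: exact_atB.
Qed.

HB.instance Definition _ :=
  GRing.isZmodClosed.Build (cochain X) cocycles cocycles_zmod.

Record cocycle := Cocycle { cocycle_val :> cochain X ;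
                            _ : cocycle_val \in cocycles }.
HB.instance Definition _ := [isSub for cocycle_val].
HB.instance Definition _ := [Choice of cocycle by <:].
HB.instance Definition _ := [SubChoice_isSubZmodule of cocycle by <:].

Definition exacts : {pred cocycle} := [pred c | `[< is_exact (val c) >]].

Lemma exacts_zmod : zmod_closed exacts.
Proof.
split=> [|c b /asboolP ce /asboolP be]; apply/asboolP => N.
  by rewrite raddf0; exact: exact_at0.
by rewrite raddfB; exact: exact_atB.
Qed.

HB.instance Definition _ := GRing.isZmodClosed.Build cocycle exacts exacts_zmod.

Definition cohom : zmodType := Quotient.quot exacts.

(* The class of a cochain, which is meant to be a cocycle; 0 otherwise. *)
Definition cls (c : cochain X) : cohom :=
  \pi_(Quotient.quot exacts) (insubd (0 : cocycle) c).

Definition coh_rep (h : cohom) : cochain X :=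
  val (repr (h : Quotient.quot exacts)).

End OneTower.

Section TwoTowers.
Variables (X Y : tower R) (phi : forall N, space X N -> space Y N).

Definition pull (c : cochain Y) : cochain X := fun s =>
  let: existT N (existT k sg) := s in c (sx (phi (N := N) \o sg)).

Definition pullback (h : cohom Y) : cohom X := cls (pull (coh_rep h)).

(* The action of the cohomology of Y on that of X, by pullback and cup product. *)
Definition coh_act (a : cohom Y) (h : cohom X) : cohom X :=
  cls (cup (pull (coh_rep a)) (coh_rep h)).

End TwoTowers.

Definition cohom_mul (X : tower R) : cohom X -> cohom X -> cohom X :=
  coh_act (fun N => id).

Definition cohom1 (X : tower R) : cohom X := cls (@cochain1 X).

End Cohomology.

(* The module M is localized at the powers of a scalar acting by s: the      *)
(* fraction (x, m) stands for x / s^m.                                        *)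
Section Localization.
Variables (M : choiceType) (s : M -> M).

Definition loc_rel (x y : M * nat) : bool :=
  `[< exists k, iter (k + y.2) s x.1 = iter (k + x.2) s y.1 >].

Lemma loc_rel_equiv : equiv_class_of loc_rel.
Proof.
split=> [x|x y|y x z].
- by apply/asboolP; exists 0%N.
- by apply/asboolP/asboolP => -[k e]; exists k.
move=> /asboolP[k e] /asboolP[l e']; apply/asboolP.
exists (k + l + y.2)%N.
rewrite (_ : k + l + y.2 + z.2 = l + z.2 + (k + y.2))%N; last by ring.
rewrite iterD e -iterD.
rewrite (_ : l + z.2 + (k + x.2) = k + x.2 + (l + z.2))%N; last by ring.
rewrite iterD e' -iterD.
by congr iter; ring.
Qed.

Canonical loc_equiv := EquivRelPack loc_rel_equiv.

Definition loc : Type := {eq_quot loc_equiv}.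

Definition frac (x : M) (m : nat) : loc := \pi_{eq_quot loc_equiv} (x, m).

Definition loc_num (q : loc) : M := (repr (q : {eq_quot loc_equiv})).1.
Definition loc_den (q : loc) : nat := (repr (q : {eq_quot loc_equiv})).2.

End Localization.

Section Borel.
Variables (R : realType) (n s : nat).
Notation C := (Cplx R).

(* The torus (C^x)^m, C^x being the nonzero complex numbers. *)
Definition torus (m : nat) : set 'rV[C]_m := [set t | forall j, t 0 j != 0].

(* A group K contained in GL_n x (C^x)^s and acting linearly on C^d is       *)
(* represented by its graph: the set of all (g, t, a), where a is the matrix *)
(* by which (g, t) in K acts on C^d.                                         *)
Definition acting (d : nat) : Type := ('M[C]_n * 'rV[C]_s * 'M[C]_d)%type.

(* E_N is the set of the pairs (A, B) with A an N x n matrix of rank n and B *)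
(* an N x s matrix with no zero column, that is V_n(C^N) x (C^N \ 0)^s, a    *)
(* free K-space whose connectivity grows with N.                             *)
Definition frames (N : nat) : set ('M[C]_(N, n) * 'M[C]_(N, s)) :=
  [set e | \rank e.1 = n /\ forall j, col j e.2 != 0].

Definition fpoint (d N : nat) : topologicalType :=
  ('cV[C]_d * ('M[C]_(N, n) * 'M[C]_(N, s)))%type.

Section Quotient.
Variables (d : nat) (K : set (acting d)).

Definition kact N (k : acting d) (p : fpoint d N) : fpoint d N :=
  (k.2 *m p.1,
   (p.2.1 *m invmx k.1.1, p.2.2 *m diag_mx (\row_j (k.1.2 0 j)^-1))).

Definition korbit N (p : fpoint d N) : set (fpoint d N) :=
  [set kact k p | k in K].

Definition orbit_rel N (p q : fpoint d N) : bool := `[< korbit p = korbit q >].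

Lemma orbit_rel_equiv N : equiv_class_of (@orbit_rel N).
Proof.
split=> [x|x y|y x z]; first exact/asboolP.
  by apply/asboolP/asboolP.
by move=> /asboolP xy /asboolP yz; apply/asboolP; rewrite xy.
Qed.

Canonical orbit_equiv N := EquivRelPack (@orbit_rel_equiv N).

Definition orbits (N : nat) : topologicalType :=
  quotient_topology {eq_quot (orbit_equiv N)}.

Definition oclass N (p : fpoint d N) : orbits N :=
  \pi_{eq_quot (orbit_equiv N)} p.

Definition orepr N (x : orbits N) : fpoint d N :=
  repr (x : {eq_quot (orbit_equiv N)}).

(* The quotients (W x E_N) / K and, on them, the function induced by f. The  *)
(* map E_N -> E_(N+1) is adding a zero row.                                  *)
Definition borel (W : set 'cV[C]_d) (f : 'cV[C]_d -> C) : tower R := {|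
  space := orbits ;
  step := fun N x => let p := orepr x in
    oclass ((p.1, (col_mx (0 : 'rV_n) p.2.1, col_mx (0 : 'rV_s) p.2.2))
            : fpoint d N.+1) ;
  dom := fun N => [set oclass p | p in W `*` @frames N] ;
  fct := fun N x => f (orepr x).1 |}.

End Quotient.

Definition induced d d' (K : set (acting d)) (K' : set (acting d'))
    (h : 'cV[C]_d -> 'cV[C]_d') N (x : orbits K N) : orbits K' N :=
  oclass K' (h (orepr x).1, (orepr x).2).

(* B(L x (C^x)^s) for a group L of invertible matrices. *)
Definition classifying (L : set 'M[C]_n) : tower R :=
  borel [set k : acting 0 | L k.1.1 /\ torus k.1.2] setT (fun=> 0).

End Borel.

Section AlgebraicGroups.
Variable R : realType.
Notation C := (Cplx R).

Inductive alg_fun (X : Type) (gen : set (X -> C)) : (X -> C) -> Prop :=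
| Alg_gen p of gen p : alg_fun gen p
| Alg_cst z : alg_fun gen (fun=> z)
| Alg_add p q of alg_fun gen p & alg_fun gen q :
    alg_fun gen (fun x => p x + q x)
| Alg_mul p q of alg_fun gen p & alg_fun gen q :
    alg_fun gen (fun x => p x * q x).

Definition regular_vec (d : nat) : ('cV[C]_d -> C) -> Prop :=
  alg_fun [set p | exists i, p = fun v : 'cV[C]_d => v i 0].

Definition regular_GL (n : nat) : ('M[C]_n -> C) -> Prop :=
  alg_fun [set p | p = (fun g : 'M[C]_n => (\det g)^-1) \/
                   exists i j, p = fun g : 'M[C]_n => g i j].

Definition regular_torus (r : nat) : ('rV[C]_r -> C) -> Prop :=
  alg_fun [set p | exists j, p = (fun t : 'rV[C]_r => t 0 j) \/
                             p = fun t : 'rV[C]_r => (t 0 j)^-1].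

(* Regular functions on a closed subgroup are restrictions of regular        *)
(* functions on the general linear group.                                    *)
Definition regular_mx (X : Type) (reg : (X -> C) -> Prop) (A : set X) m
    (a : X -> 'M[C]_m) :=
  forall i j, exists2 p, reg p & forall x, A x -> a x i j = p x.

Definition algebraic_group n (G : set 'M[C]_n) :=
  [/\ exists2 I : set ('M[C]_n -> C), I `<=` @regular_GL n &
        G = [set g | g \in unitmx /\ forall p, I p -> p g = 0],
      G 1%:M, forall g h, G g -> G h -> G (g *m h)
    & forall g, G g -> G (invmx g)].

Definition unipotent n (g : 'M[C]_n) := exists m, (g - 1%:M) ^+ m = 0.

Definition connected_reductive n (G : set 'M[C]_n) :=
  [/\ algebraic_group G, connected G &
   forall U : set 'M[C]_n, algebraic_group U -> U `<=` G ->
     (forall g u, G g -> U u -> U (g *m u *m invmx g)) ->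
     connected U -> (forall u, U u -> unipotent u) -> U = [set 1%:M]].

Definition rational_rep n m (G : set 'M[C]_n) (rho : 'M[C]_n -> 'M[C]_m) :=
  [/\ regular_mx (@regular_GL n) G rho, rho 1%:M = 1%:M &
   forall g h, G g -> G h -> rho (g *m h) = rho g *m rho h].

Definition torus_rep r m (tau : 'rV[C]_r -> 'M[C]_m) :=
  [/\ regular_mx (@regular_torus r) (@torus R r) tau,
      tau (const_mx 1) = 1%:M &
   forall t u, torus t -> torus u ->
     tau (\row_j (t 0 j * u 0 j)) = tau t *m tau u].

(* A torus of rank r in G, given by an isomorphism of (C^x)^r with it. *)
Definition torus_in n r (G : set 'M[C]_n) (tau : 'rV[C]_r -> 'M[C]_n) :=
  [/\ torus_rep tau, {in @torus R r &, injective tau} &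
   tau @` @torus R r `<=` G].

Definition maximal_torus n r (G : set 'M[C]_n) (tau : 'rV[C]_r -> 'M[C]_n) :=
  torus_in G tau /\
  forall r' (tau' : 'rV[C]_r' -> 'M[C]_n), torus_in G tau' ->
    tau @` @torus R r `<=` tau' @` @torus R r' ->
    tau' @` @torus R r' = tau @` @torus R r.

Definition char_eval r (a : 'rV[int]_r) (t : 'rV[C]_r) : C :=
  \prod_j t 0 j ^ a 0 j.

Definition cochar_eval r (l : 'rV[int]_r) (z : C) : 'rV[C]_r :=
  \row_j z ^ l 0 j.

(* The Zariski tangent space at the identity. *)
Definition lie_algebra n (G : set 'M[C]_n) : set 'M[C]_n :=
  [set Z | forall p, @regular_GL n p -> (forall g, G g -> p g = 0) ->
     derive1 (fun z : C => p (1%:M + z *: Z)) 0 = 0].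

(* The dimension of a set of vectors that is a linear subspace. *)
Definition dim_of (vT : vectType C) (S : set vT) : nat :=
  \max_(m < (dim vT).+1 |
      `[< exists W : {vspace vT}, \dim W = m /\ forall w, w \in W -> S w >]) m.

End AlgebraicGroups.

(* T and T' are given by parametrizations by (C^x)^r and (C^x)^s, so that    *)
(* X_*(T) = X^*(T) = Z^r, h_R = R^r and X^*(T x T') = Z^r x Z^s.  V = C^d.   *)
Record setup (R : realType) (n d r s : nat) := Setup {
  grpG : set 'M[Cplx R]_n ;
  tau : 'rV[Cplx R]_r -> 'M[Cplx R]_n ;
  rho : 'M[Cplx R]_n -> 'M[Cplx R]_d ;
  rho' : 'rV[Cplx R]_s -> 'M[Cplx R]_d ;
  pot : 'cV[Cplx R]_d -> Cplx R }.

Section Setup.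
Variables (R : realType) (n d r s : nat) (D : setup R n d r s).
Notation C := (Cplx R).
Notation hR := 'rV[R]_r.
Notation weight := ('rV[int]_r * 'rV[int]_s)%type.

Definition admissible :=
  [/\ connected_reductive (grpG D), maximal_torus (grpG D) (tau D),
      rational_rep (grpG D) (rho D) & torus_rep (rho' D)] /\
  [/\ forall g t, grpG D g -> torus t ->
        rho D g *m rho' D t = rho' D t *m rho D g,
      regular_vec (pot D),
      forall g v, grpG D g -> pot D (rho D g *m v) = pot D v &
      forall t v, torus t -> pot D (rho' D t *m v) = pot D v].

Definition weight_V (al : weight) : set 'cV[C]_d :=
  [set v | (forall t, torus t ->
              rho D (tau D t) *m v = char_eval al.1 t *: v) /\
           (forall t, torus t -> rho' D t *m v = char_eval al.2 t *: v)].

(* T' acts trivially on the Lie algebra. *)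
Definition weight_g (al : weight) : set 'M[C]_n :=
  [set Z | [/\ lie_algebra (grpG D) Z,
      forall t, torus t ->
        tau D t *m Z *m invmx (tau D t) = char_eval al.1 t *: Z &
      forall t : 'rV[C]_s, torus t -> Z = char_eval al.2 t *: Z]].

Definition mult_V (al : weight) : nat := dim_of (weight_V al).
Definition mult_g (al : weight) : nat := dim_of (weight_g al).

Definition T_weight (a : 'rV[int]_r) :=
  (exists2 v : 'cV[C]_d, v != 0 &
     forall t, torus t -> rho D (tau D t) *m v = char_eval a t *: v) \/
  (exists2 Z : 'M[C]_n, Z != 0 & lie_algebra (grpG D) Z /\
     forall t, torus t ->
       tau D t *m Z *m invmx (tau D t) = char_eval a t *: Z).

Definition pairing (a : 'rV[int]_r) (x : hR) : R :=
  \sum_j (a 0 j)%:~R * x 0 j.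

Definition hyperplanes : set (set hR) :=
  [set H | exists a, [/\ a != 0, T_weight a & H = [set x | pairing a x = 0]]].

Definition flat (F : set hR) :=
  exists2 S, S `<=` hyperplanes & F = \bigcap_(H in S) H.

Definition cell (A : set hR) :=
  exists2 S, S `<=` hyperplanes &
    let M := (\bigcap_(H in S) H) `\` (\bigcup_(H in hyperplanes `\` S) H) in
    exists2 x, M x & A = connected_component M x.

Definition lspan (A : set hR) : set hR :=
  \bigcap_(W in [set W : set hR | [/\ A `<=` W, W 0 &
      forall (z : R) x y, W x -> W y -> W (z *: x + y)]]) W.

Definition prec_cell (A A' : set hR) := A' `<=` closure A.
Definition prec_flat (A F : set hR) := F `<=` lspan A.

Definition generic (F : set hR) (l : 'rV[int]_r) :=
  let x : hR := map_mx intr l in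
  F x /\ forall H, hyperplanes H -> H x -> F `<=` H.

Definition fixed_space (l : 'rV[int]_r) : set 'cV[C]_d :=
  [set v | forall z, z != 0 -> rho D (tau D (cochar_eval l z)) *m v = v].

Definition centralizer (l : 'rV[int]_r) : set 'M[C]_n :=
  [set g | grpG D g /\ forall z, z != 0 ->
     g *m tau D (cochar_eval l z) = tau D (cochar_eval l z) *m g].

(* V^l / (G^l x T') with the function induced by f. *)
Definition fixed_stack (l : 'rV[int]_r) : tower R :=
  borel [set k : acting R n s d |
           [/\ centralizer l k.1.1, torus k.1.2
             & k.2 = rho D k.1.1 *m rho' D k.1.2]]
        (fixed_space l) (pot D).

Definition BG (l : 'rV[int]_r) : tower R := classifying s (centralizer l).
Definition BT : tower R := classifying s (tau D @` @torus R r).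

(* The principal C^x-bundle over BT of the line bundle of weight al. *)
Definition line_bundle (al : weight) : tower R :=
  borel [set k : acting R n s 1 | exists t t',
           [/\ torus t, torus t' &
            k = (tau D t, t', (char_eval al.1 t * char_eval al.2 t')%:M)]]
        [set v | v 0 0 != 0] (fun=> 0).

(* The loop of angle 2 pi in the fibre over the class of e. *)
Definition fibre_loop (al : weight) N (e : 'M[C]_(N, n) * 'M[C]_(N, s))
    (t : simplex R 1) : space (line_bundle al) N :=
  let x := pi *+ 2 * val t 0 ord_max in
  oclass _ ((const_mx (cos x +i* sin x)%C, e) : fpoint R n s 1 N).

(* The first Chern class, by transgression: if a cochain b on the principal  *)
(* C^x-bundle restricts to the positive generator of the cohomology of the   *)
(* fibres and is such that the coboundary of b is the pullback of -c, then c *)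
(* is a representative of the first Chern class.                             *)
Definition is_chern1 (al : weight) (h : cohom BT) :=
  exists c : cocycle BT, [/\ h = cls (val c),
    forall x, sdim x != 2%N -> val c x = 0,
    forall N x, dom BT N x -> val c (sx (fun _ : simplex R 2 => x)) = 0 &
    exists b : cochain (line_bundle al), forall N,
      zero_on (dom (line_bundle al) N)
        (cobound b + pull (X := line_bundle al) (Y := BT)
                    (@induced R n s 1 0 _ _ (fun=> 0)) (val c)) /\
      forall e, @frames R n s N e -> b (sx (fibre_loop al e)) = 1].

Definition chern1 (al : weight) : cohom BT := xget 0 (is_chern1 al).

Definition neg_on (A F : set hR) : set weight :=
  [set al | (forall x, A x -> pairing al.1 x < 0) /\
            (forall x, F x -> pairing al.1 x = 0)].

(* The product of the al^(mult al), in the cohomology of BT. *)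
Definition euler_T (mult : weight -> nat) (A F : set hR) : cohom BT :=
  \big[@cohom_mul R BT/cohom1 BT]_(al \in neg_on A F)
    iter (mult al) (cohom_mul (chern1 al)) (cohom1 BT).

Definition to_BT (l : 'rV[int]_r) : cohom (BG l) -> cohom BT :=
  pullback (X := BT) (Y := BG l) (@induced R n s 0 0 _ _ id).

Definition to_BG (l l' : 'rV[int]_r) : cohom (BG l) -> cohom (BG l') :=
  pullback (X := BG l') (Y := BG l) (@induced R n s 0 0 _ _ id).

(* Below, lam chooses a generic cocharacter in each flat. *)
Variable lam : set hR -> 'rV[int]_r.

Definition euler (mult : weight -> nat) (A F : set hR) :
    cohom (BG (lam (lspan A))) :=
  xget 0 [set e | to_BT e = euler_T mult A F].

Definition HF (F : set hR) : zmodType := cohom (fixed_stack (lam F)).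

Definition eu_act (F : set hR) (a : cohom (BG (lam F))) : HF F -> HF F :=
  coh_act (X := fixed_stack (lam F)) (Y := BG (lam F))
    (@induced R n s d 0 _ _ (fun=> 0)) a.

Definition HCF (A F : set hR) : Type := loc (eu_act (euler mult_V A F)).

Definition istar (F' F : set hR) : HF F -> HF F' :=
  pullback (X := fixed_stack (lam F')) (Y := fixed_stack (lam F))
    (@induced R n s d d _ _ id).

Definition Res (A F : set hR) (x : HF F) : HCF A F :=
  frac _ (eu_act (euler mult_g A F) (istar (lspan A) x)) 1.

(* The extension of Res A (lspan A') to the localization HCF A' F, for       *)
(* A <= A' <= F.  With e1 = Eu_{V,A,A'} and e2 = Eu_{V,A',F}, whose product  *)
(* is Eu_{V,A,F}, it sends x / e2^m to Res x / e2^m, which is e1^m Res x /   *)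
(* (e1 e2)^m, while y / e1^k in HCF A (lspan A') is e2^k y / (e1 e2)^k in    *)
(* HCF A F.                                                                  *)
Definition Res_ext (A A' F : set hR) (q : HCF A' F) : HCF A F :=
  let e1 := eu_act (euler mult_V A (lspan A')) in
  let e2 := eu_act (to_BG (lam (lspan A)) (euler mult_V A' F)) in
  let y := Res A (loc_num q) in
  frac _ (iter (loc_den q) e1 (iter (loc_den y) e2 (loc_num y)))
    (loc_den q + loc_den y)%N.

End Setup.

Arguments to_BT {R n d r s} D l.

(* Main.v *)
From HB Require Import structures.
From mathcomp Require Import all_boot all_order all_algebra.
From mathcomp Require Import all_classical all_reals all_analysis.
From mathcomp.real_closed Require Import complex.
From mathcomp Require Import ring zify.
Require Import Defs.

Import Order.TTheory GRing.Theory Num.Theory.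
Import numFieldNormedType.Exports.
Local Open Scope classical_set_scope.
Local Open Scope ring_scope.
Local Open Scope quotient_scope.

Set Implicit Arguments.
Unset Strict Implicit.
Unset Printing Implicit Defensive.

(* Computing with cochains, the cohomology of BG acts on vanishing cycle      *)
(* cohomology by cup product (associative, by the Leibniz rule well defined   *)
(* on classes), and the pullbacks i^* are functorial and semilinear for this  *)
(* action.  The proposition is then the multiplicativity                      *)
(*   Eu_{U,C,F} = Eu_{U,C,<C'>} Eu_{U,C',F}                                   *)
(* for U = V and U = g: a weight which is negative on C and vanishes on F     *)
(* either vanishes on C', or is negative on C' because C' lies in the closure *)
(* of C, and conversely, weights having constant sign on cells.  The products *)
(* may be reordered because classes of degree two commute.  Finally i^* is    *)
(* defined because V^L is contained in V^F for F in L: V is a sum of weight   *)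
(* spaces, and a weight vanishing on a generic cocharacter of L vanishes on L.*)

(** * Cochains as functions on vertex lists *)

(** Put L = <C> and L' = <C'>. Both sides are pullbacks of [x] to V^L multiplied by quotients of
    Euler classes, and three facts identify them. The pullbacks compose ([istar_comp]). They are
    semilinear over the cohomology of the classifying spaces ([istar_act]), so the Euler classes
    introduced by the first restriction can be moved past the second pullback. Finally Eu_{C,F} =
    Eu_{C,L'} Eu_{C',F}, for V and for the Lie algebra ([euler_T_mul]): the weights negative on C
    and zero on F are those that also vanish on C', together with those negative on C' and zero on F
    ([neg_on_split]). Comparing the fractions is then formal ([frac_extension]).

    Statements on cohomology are reduced to identities of cochains: [pullback_cls] and [coh_act_cls]
    show that operations defined on chosen representatives depend only on the classes. Commutativity
    is established for products of classes of degree two ([degree2_genC]), by a cup-1 homotopy. The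
    product formula is proved in the cohomology of BT and brought back to that of BG^L by
    injectivity of [to_BT]. On the geometric side, the span of a cell is a flat ([lspan_component]),
    a weight has constant sign on a cell ([cell_sign]), and the weight decomposition of V gives the
    inclusions between fixed spaces ([fixed_space_sub]). *)

(* A cochain c and a simplex sg define the function on lists of vertices     *)
(* whose value at s is that of c on the face s of sg (see [ev] below).       *)
(* Coboundary and cup product become [dlist] and [cuplist], and the Leibniz  *)
(* rule and associativity are proved by induction on lists.                  *)
Section VertexLists.
Variables (T : Type).
Implicit Types (A B E : seq T -> rat) (s : seq T).

(** Deleting the head leaves [A t]; deleting a later vertex is the same operation on [t] with the
    head kept in front, with the opposite sign. On a single vertex this gives [A [::]], as for the
    augmented coboundary. *)
Fixpoint dlist A s : rat :=
  if s is x :: t then A t - dlist (fun u => A (x :: u)) t else 0.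

Fixpoint cuplist A B s : rat :=
  if s is x :: t then A [:: x] * B s + cuplist (fun u => A (x :: u)) B t else 0.

(** A list of k + 1 vertices has degree k, and [(size s).+1] has the parity of k. *)
Definition sgnlist A s : rat := (-1) ^+ (size s).+1 * A s.

Lemma eq_dlist A B s : A =1 B -> dlist A s = dlist B s.
Proof.
elim: s A B => //= x s IHs A B eAB; rewrite eAB; congr (_ - _).
by apply: IHs => u; rewrite eAB.
Qed.

Lemma dlistD A B s : dlist (fun u => A u + B u) s = dlist A s + dlist B s.
Proof.
elim: s A B => //= x s IHs A B.
by rewrite (IHs (fun u => A (x :: u)) (fun u => B (x :: u))); ring.
Qed.

Lemma dlistZ k A s : dlist (fun u => k * A u) s = k * dlist A s.
Proof.
elim: s A => //= [|x s IHs] A; first by rewrite mulr0.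
by rewrite (IHs (fun u => A (x :: u))); ring.
Qed.

Lemma dlistE A s :
  dlist A s = \sum_(i < size s) (-1) ^+ i * A (take i s ++ drop i.+1 s).
Proof.
elim: s A => /= [|x s IHs] A; first by rewrite big_ord0.
rewrite big_ord_recl /= expr0 mul1r drop0 IHs; congr (_ + _).
rewrite -sumrN; apply: eq_bigr => i _.
by rewrite /bump /= add1n exprS; ring.
Qed.

Lemma eq_cuplist A A' B s : A =1 A' -> cuplist A B s = cuplist A' B s.
Proof.
elim: s A A' => //= x s IHs A A' eA; rewrite eA; congr (_ + _).
by apply: IHs => u; rewrite eA.
Qed.

Lemma cuplistDl A A' B s :
  cuplist (fun u => A u + A' u) B s = cuplist A B s + cuplist A' B s.
Proof.
elim: s A A' => //= x s IHs A A'.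
by rewrite (IHs (fun u => A (x :: u)) (fun u => A' (x :: u))); ring.
Qed.

Lemma cuplistZl k A B s : cuplist (fun u => k * A u) B s = k * cuplist A B s.
Proof.
elim: s A => //= [|x s IHs] A; first by rewrite mulr0.
by rewrite (IHs (fun u => A (x :: u))); ring.
Qed.

Lemma cuplistE A B s :
  cuplist A B s = \sum_(p < size s) A (take p.+1 s) * B (drop p s).
Proof.
elim: s A => /= [|x s IHs] A; first by rewrite big_ord0.
by rewrite big_ord_recl /= take0 IHs.
Qed.

Lemma cuplistA A B E s :
  cuplist (cuplist A B) E s = cuplist A (cuplist B E) s.
Proof.
elim: s A => //= x s IHs A; rewrite addr0.
rewrite (cuplistDl (fun u => A [:: x] * B (x :: u))).
rewrite (cuplistZl _ (fun u => B (x :: u))).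
by rewrite (IHs (fun u => A (x :: u))); ring.
Qed.

(** The Leibniz rule. The term [A [::] * B s] removes the augmentation part of [dlist A]. It is kept
    for the induction, which replaces [A] by [fun u => A (x :: u)], whose value at the empty list
    may be nonzero. *)
Lemma dlist_cuplist A B s : B [::] = 0 -> (0 < size s)%N ->
  dlist (cuplist A B) s =
  cuplist (dlist A) B s - A [::] * B s + cuplist (sgnlist A) (dlist B) s.
Proof.
move=> B0; elim: s A => //= x [|y s] IHs A _.
  by rewrite /= B0; ring.
rewrite (dlistD (fun u => A [:: x] * B (x :: u))).
rewrite (dlistZ _ (fun u => B (x :: u))) (IHs (fun u => A (x :: u)))//.
rewrite subr0 -/(cuplist A B (y :: s)).
have -> : cuplist (fun u => A u - dlist (fun v => A (x :: v)) u) B (y :: s) =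
    cuplist A B (y :: s) - cuplist (dlist (fun v => A (x :: v))) B (y :: s).
  rewrite (cuplistDl A (fun u => - dlist (fun v => A (x :: v)) u)) -mulN1r.
  rewrite -cuplistZl; congr (_ + _); apply: eq_cuplist => u.
  by rewrite mulN1r.
have -> : cuplist (fun u => sgnlist A (x :: u)) (dlist B) (y :: s) =
    - cuplist (sgnlist (fun v => A (x :: v))) (dlist B) (y :: s).
  rewrite -mulN1r -cuplistZl; apply: eq_cuplist => u.
  by rewrite /sgnlist /= exprS; ring.
by rewrite /sgnlist /=; ring.
Qed.

End VertexLists.

(** * Affine maps between standard simplices *)

Lemma mx_continuous (T : topologicalType) (K : topologicalType) m n
    (f : T -> 'M[K]_(m, n)) :
  (forall i j, continuous (fun x => f x i j)) -> continuous f.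
Proof.
move=> fc x A [P fP PA].
have : \forall y \near x, forall ij : 'I_m * 'I_n, P ij.1 ij.2 (f y ij.1 ij.2).
  by apply: filter_forall => -[i j]; apply: (fc i j x); exact: fP.
by apply: filterS => y Py; apply: PA => i j; exact: (Py (i, j)).
Qed.

Lemma push_id (R : realType) k (th : 'I_k.+1 -> 'I_k.+1) (t : simplex R k) :
  th =1 id -> push th t = t.
Proof.
move=> thE; apply: val_inj; apply/rowP => l /=; rewrite mxE.
rewrite (eq_bigl (pred1 l)) => [|i]; last by rewrite thE.
by rewrite big_pred1_eq.
Qed.

Lemma push_comp (R : realType) i j k (th : 'I_j.+1 -> 'I_k.+1)
    (th' : 'I_i.+1 -> 'I_j.+1) (t : simplex R i) :
  push th (push th' t) = push (th \o th') t.
Proof.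
apply: val_inj; apply/rowP => l /=; rewrite !mxE.
under eq_bigr do rewrite mxE.
rewrite [RHS](partition_big th' (fun m => th m == l)) //=.
apply: eq_bigr => m /eqP <-; apply: eq_bigl => a.
by case: eqVneq => [->|]; rewrite ?andbF ?eqxx.
Qed.

Lemma push_continuous (R : realType) j k (th : 'I_j.+1 -> 'I_k.+1) :
  continuous (@push R j k th).
Proof.
apply/continuousP => _ [B oB <-]; rewrite -comp_preimage.
have : continuous (set_val \o @push R j k th).
  rewrite (_ : _ \o _ =
    (fun u : 'rV[R]_j.+1 => \row_l \sum_(i | th i == l) u 0 i) \o set_val);
    last first.
    by apply/funext => u /=.
  move=> u; apply: continuous_comp; first exact: initial_continuous.
  apply: mx_continuous => i l; rewrite ord1.
  rewrite (_ : (fun _ => _) =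
    fun x : 'rV[R]_j.+1 => \sum_(a | th a == l) x 0 a); last first.
    by apply/funext => y; rewrite mxE.
  apply: continuous_big => [y|a _]; last exact: coord_continuous.
  exact: add_continuous.
by move/continuousP; apply.
Qed.

(** * Coboundary, cup and cup-1 products through vertex lists *)

Section Faces.
Variables (R : realType) (X : tower R).
Implicit Types (c b : cochain X) (N k : nat).

(** Lists are arbitrary, repetitions included, and the default of [nth] is never reached. The value
    0 at the empty list kills the augmentation terms. *)
Definition ev c N k (sg : simplex R k -> space X N) (s : seq 'I_k.+1) : rat :=
  if s is x :: t then
    c (sx (sg \o push (fun j : 'I_(size t).+1 => nth x s j)))
  else 0.

(** Faces arise with a dimension [m] that is only provably the length of a list minus one; leaving
    [m] free avoids transports along that equality. *)
Lemma ev_face c N k (sg : simplex R k -> space X N) m (v : 'I_m.+1 -> 'I_k.+1) s :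
  size s = m.+1 -> (forall x (j : 'I_m.+1), v j = nth x s j) ->
  c (sx (sg \o push v)) = ev c sg s.
Proof.
case: s => //= x t [tm]; case: _ / tm v => v vE.
by rewrite (_ : v = fun j : 'I_(size t).+1 => nth x (x :: t) j)//; apply/funext.
Qed.

Lemma ev_enum c N k (sg : simplex R k -> space X N) :
  c (sx sg) = ev c sg (enum 'I_k.+1).
Proof.
rewrite -(@ev_face _ _ _ _ k id); last 2 first.
- by rewrite size_enum_ord.
- by move=> x j; rewrite nth_ord_enum.
by congr (c (sx _)); apply/funext => t /=; rewrite push_id.
Qed.

Lemma ev_cobound c N k (sg : simplex R k -> space X N) s :
  ev (cobound c) sg s = dlist (ev c sg) s.
Proof.
case: s => // x [|y t]; first by rewrite /= subr0.
set v := fun j : 'I_(size t).+2 => nth x [:: x, y & t] j.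
have -> : ev (cobound c) sg [:: x, y & t] = \sum_(i < (size t).+2)
    (-1) ^+ i * c (sx ((sg \o push v) \o push (lift i))) by [].
rewrite dlistE; apply: eq_bigr => i _; congr (_ * _).
rewrite -(@ev_face c N k sg (size t) (v \o lift i)).
- by congr (c (sx _)); apply/funext => u /=; rewrite push_comp.
- by rewrite size_cat size_take ltn_ord size_drop subnS /=; have := ltn_ord i; lia.
- move=> z j; rewrite /v /= nth_cat size_take /= ltn_ord /bump.
  case: (ltnP j i) => ji.
    rewrite add0n ?ji nth_take//; apply: set_nth_default => /=.
    by have := ltn_ord j; lia.
  rewrite nth_drop subnKC// add1n; apply: set_nth_default => /=.
  by have := ltn_ord j.
Qed.

Lemma ev_cup c b N k (sg : simplex R k -> space X N) s :
  ev (cup c b) sg s = cuplist (ev c sg) (ev b sg) s.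
Proof.
case: s => // x t; set v := fun j : 'I_(size t).+1 => nth x (x :: t) j.
have -> : ev (cup c b) sg (x :: t) = \sum_(p < (size t).+1)
    c (sx ((sg \o push v) \o push (fun j : 'I_p.+1 => inord j))) *
    b (sx ((sg \o push v) \o
             push (fun j : 'I_(size t - p).+1 => inord (p + j)))) by [].
rewrite cuplistE; apply: eq_bigr => p _.
have pt := ltn_ord p; congr (_ * _).
- rewrite -(@ev_face c N k sg p (v \o (fun j : 'I_p.+1 => inord j))).
  + by congr (c (sx _)); apply/funext => u /=; rewrite push_comp.
  + by rewrite size_take; case: ltnP => // pt'; apply/eqP; rewrite eqn_leq pt' pt.
  + move=> z j; have jp := ltn_ord j; rewrite /v [LHS]/= inordK; last by lia.
    by rewrite nth_take//; apply: set_nth_default => /=; lia.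
- rewrite -(@ev_face b N k sg (size t - p)
    (v \o (fun j : 'I_(size t - p).+1 => inord (p + j)))).
  + by congr (b (sx _)); apply/funext => u /=; rewrite push_comp.
  + by rewrite size_drop /=; lia.
  + move=> z j; have jp := ltn_ord j; rewrite /v [LHS]/= inordK; last by lia.
    by rewrite nth_drop; apply: set_nth_default => /=; lia.
Qed.

Lemma cochain_eqP c b :
  (forall N k (sg : simplex R k -> space X N), c (sx sg) = b (sx sg)) -> c = b.
Proof. by move=> cb; apply/funext => -[N [k sg]]; exact: cb. Qed.

Definition sgnc c : cochain X := fun s => (-1) ^+ sdim s * c s.

Lemma ev_sgnc c N k (sg : simplex R k -> space X N) s :
  ev (sgnc c) sg s = sgnlist (ev c sg) s.
Proof.
by case: s => [|x t]; rewrite /sgnlist /= ?mulr0// /sgnc /sdim /= !exprS; ring.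
Qed.

Lemma cobound_cup c b :
  cobound (cup c b) = cup (cobound c) b + cup (sgnc c) (cobound b).
Proof.
apply: cochain_eqP => N k sg; rewrite !fctE !ev_enum ev_cobound !ev_cup.
rewrite (eq_dlist _ (ev_cup c b sg)).
rewrite dlist_cuplist// ?size_enum_ord// mul0r subr0.
rewrite (eq_cuplist _ _ (ev_sgnc c sg)) (eq_cuplist _ _ (ev_cobound c sg)).
by congr (_ + _); rewrite !cuplistE; apply: eq_bigr => i _; rewrite ev_cobound.
Qed.

Lemma cup_assoc a c b : cup (cup a c) b = cup a (cup c b).
Proof.
apply: cochain_eqP => N k sg; rewrite !ev_enum !ev_cup.
rewrite (eq_cuplist _ _ (ev_cup a c sg)) cuplistA.
by rewrite !cuplistE; apply: eq_bigr => i _; rewrite ev_cup.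
Qed.

Lemma cup1c c : cup (@cochain1 R X) c = c.
Proof.
apply: cochain_eqP => N k sg; rewrite !ev_enum ev_cup cuplistE.
have := size_enum_ord k.+1; case: (enum _) => // x t _.
rewrite /= big_ord_recl take0 mul1r big1 ?addr0// => i _ /=.
by case: t i => [[]//|y t] i; rewrite mul0r.
Qed.

Lemma cupc1 c : cup c (@cochain1 R X) = c.
Proof.
apply: cochain_eqP => N k sg; rewrite !ev_enum ev_cup cuplistE.
have := size_enum_ord k.+1; case/lastP: (enum _) => // t x _.
rewrite size_rcons big_ord_recr /= -{1}(size_rcons t x) take_size big1 ?add0r.
  by rewrite drop_rcons// drop_size mulr1.
move=> i _; rewrite [X in _ * X](_ : _ = 0) ?mulr0//.
rewrite drop_rcons; last exact: ltnW.
have : (0 < size (drop i t))%N by rewrite size_drop subn_gt0.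
case: (drop i t) => // y u _ /=; rewrite /cochain1 /sdim /= size_rcons.
by [].
Qed.

Lemma cupBl a c b : cup (a - c) b = cup a b - cup c b.
Proof.
apply: cochain_eqP => N k sg; rewrite !fctE /= -sumrB; apply: eq_bigr => i _.
by rewrite !fctE mulrBl.
Qed.

Lemma cupBr a c b : cup b (a - c) = cup b a - cup b c.
Proof.
apply: cochain_eqP => N k sg; rewrite !fctE /= -sumrB; apply: eq_bigr => i _.
by rewrite !fctE mulrBr.
Qed.

Lemma cobound1 : cobound (@cochain1 R X) = 0.
Proof.
apply: cochain_eqP => N k sg; rewrite !ev_enum ev_cobound.
case: (enum _) => // x [|y [|z t]].
- by rewrite /= subr0.
- by rewrite /= /cochain1 /= !subr0 subrr.
rewrite dlistE big1// => i _.
have : (1 < size (take i [:: x, y & z :: t] ++ drop i.+1 [:: x, y & z :: t]))%N.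
  by rewrite size_cat size_take size_drop ltn_ord /=; have := ltn_ord i; lia.
by case: (_ ++ _) => [//|u [//|w l]] _; rewrite /= /cochain1 /sdim mulr0.
Qed.

Lemma cobound_sgnc c : cobound (sgnc c) = - sgnc (cobound c).
Proof.
apply: cochain_eqP => N k sg; rewrite !fctE /sgnc /sdim /=.
case: k sg => [|k] sg /=; first by rewrite mulr0 oppr0.
rewrite mulr_sumr -sumrN; apply: eq_bigr => i _; rewrite /sgnc /sdim /= exprS.
by ring.
Qed.

Lemma sdim_cup_ge m n c b :
  (forall s, (m <= sdim s)%N -> c s = 0) ->
  (forall s, (n <= sdim s)%N -> b s = 0) ->
  forall s, (m + n <= sdim s)%N -> cup c b s = 0.
Proof.
move=> c0 b0 [N [k sg]]; rewrite /sdim /= => mnk; apply: big1 => p _.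
have [mp|pm] := leqP m p; first by rewrite c0 ?mul0r.
by rewrite b0 ?mulr0// /sdim /=; lia.
Qed.

(** Steenrod's cup-1 formula for two factors of degree 2, a cochain of degree 3. *)
Definition cup1 c b : cochain X := fun s =>
  let: existT N (existT k sg) := s in
  if k != 3%N then 0 else
  let face l := sg \o push (fun j : 'I_3 => inord (nth 0%N l j)) in
  c (sx (face [:: 0; 2; 3]%N)) * b (sx (face [:: 0; 1; 2]%N)) -
  c (sx (face [:: 0; 1; 3]%N)) * b (sx (face [:: 1; 2; 3]%N)).

Lemma ev_cup1 c b N k (sg : simplex R k -> space X N) x0 x1 x2 x3 :
  ev (cup1 c b) sg [:: x0; x1; x2; x3] =
  ev c sg [:: x0; x2; x3] * ev b sg [:: x0; x1; x2] -
  ev c sg [:: x0; x1; x3] * ev b sg [:: x1; x2; x3].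
Proof.
rewrite {1}/ev /cup1 /=.
set v := (fun j => nth _ _ _).
have e (a : cochain X) i0 i1 i2 : (i0 < 4)%N -> (i1 < 4)%N -> (i2 < 4)%N ->
   a (sx ((sg \o push v) \o
            push (fun j : 'I_3 => inord (nth 0%N [:: i0; i1; i2] j)))) =
   ev a sg [:: nth x0 [:: x0; x1; x2; x3] i0; nth x0 [:: x0; x1; x2; x3] i1;
      nth x0 [:: x0; x1; x2; x3] i2].
  move=> l0 l1 l2.
  rewrite -(@ev_face a N k sg 2
     (v \o (fun j : 'I_3 => inord (nth 0%N [:: i0; i1; i2] j)))) //.
    by congr (a (sx _)); apply/funext => u /=; rewrite push_comp.
  by move=> z [[|[|[|//]]] lj]; rewrite /v /= inordK.
by rewrite !e.
Qed.

(* Steenrod's cup-1 product is the homotopy between the two orders of a cup  *)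
(* product; only degree 2 is needed, Euler classes being products of first   *)
(* Chern classes.                                                            *)
Lemma cobound_cup1 c b N k (sg : simplex R k -> space X N) :
  (forall s, sdim s != 2%N -> c s = 0) -> (forall s, sdim s != 2%N -> b s = 0) ->
  (forall s, dlist (ev c sg) s = 0) -> (forall s, dlist (ev b sg) s = 0) ->
  cobound (cup1 c b) (sx sg) = (cup b c - cup c b) (sx sg).
Proof.
move=> c2 b2 dc db; have sz := size_enum_ord k.+1.
have z2 (a : cochain X) s : (forall s, sdim s != 2%N -> a s = 0) ->
    size s != 3%N -> ev a sg s = 0.
  by case: s => // x t a2 st; apply: a2.
(* For degree reasons both sides vanish unless the simplex has dimension 4. *)
have [k4|k4] := eqVneq k 4%N; last first.
  rewrite !fctE !ev_enum ev_cobound !ev_cup !cuplistE dlistE.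
  rewrite !big1 ?subrr// => i _; move: (nat_of_ord i) (ltn_ord i) => {}i;
    rewrite sz => ik.
  - have [s3|s3] := eqVneq (size (drop i (enum 'I_k.+1))) 3%N; last first.
      by rewrite (z2 b)// mulr0.
    rewrite (z2 c) ?mul0r//; rewrite size_take sz.
    by move: s3; rewrite size_drop sz; case: ifP; lia.
  - have [s3|s3] := eqVneq (size (drop i (enum 'I_k.+1))) 3%N; last first.
      by rewrite (z2 c)// mulr0.
    rewrite (z2 b) ?mul0r//; rewrite size_take sz.
    by move: s3; rewrite size_drop sz; case: ifP; lia.
  - have : size (take i (enum 'I_k.+1) ++ drop i.+1 (enum 'I_k.+1)) != 4%N.
      by rewrite size_cat size_take size_drop sz ik; lia.
    case: (_ ++ _) => [|u l]; first by rewrite mulr0.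
    by rewrite /= eqSS => ->; rewrite mulr0.
rewrite !fctE !ev_enum ev_cobound !ev_cup; have := etrans sz (congr1 S k4).
case: (enum _) => [//|x0 [//|x1 [//|x2 [//|x3 [//|x4 [|//]]]]]] _.
rewrite /cuplist /dlist !ev_cup1.
rewrite ?(z2 c [:: _])// ?(z2 b [:: _])//.
rewrite ?(z2 c [:: _; _])// ?(z2 b [:: _; _])//.
rewrite ?(z2 c [:: _; _; _; _])// ?(z2 b [:: _; _; _; _])//.
rewrite ?(z2 c [:: _; _; _; _; _])// ?(z2 b [:: _; _; _; _; _])//.
(* The cocycle identity rewrites the triangles avoiding [x0] in terms of triangles through [x0]; a
   polynomial identity remains. *)
have tri (a : cochain X) y0 y1 y2 y3 : (forall s, dlist (ev a sg) s = 0) ->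
    ev a sg [:: y1; y2; y3] = ev a sg [:: y0; y2; y3] -
      ev a sg [:: y0; y1; y3] + ev a sg [:: y0; y1; y2].
  move=> /(_ [:: y0; y1; y2; y3]); rewrite /dlist => e.
  by apply/eqP; rewrite -subr_eq0; apply/eqP; rewrite -[RHS]e; ring.
rewrite (tri c x0 x1 x2 x4 dc) (tri c x0 x1 x3 x4 dc) (tri c x0 x2 x3 x4 dc).
rewrite (tri b x0 x1 x2 x3 db) (tri b x0 x1 x2 x4 db) (tri b x0 x1 x3 x4 db).
rewrite (tri b x0 x2 x3 x4 db).
by ring.
Qed.

End Faces.
(** * Pullbacks and cup products of cocycles *)

Section Pulling.
Variable R : realType.

(** The shift of stages [m] makes [restr] (shift by one) and [pull] (no shift) two cases of one
    construction. *)
Definition gpull (X Y : tower R) (m : nat -> nat)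
    (phi : forall N, space X N -> space Y (m N)) (c : cochain Y) : cochain X :=
  fun s => let: existT N (existT k sg) := s in c (sx (phi N \o sg)).

Definition stage_map (X Y : tower R) N M (f : space X N -> space Y M) :=
  continuous f /\ forall x, dom X N x -> dom Y M (f x).

Definition fct_map (X Y : tower R) N M (f : space X N -> space Y M) :=
  forall x, dom X N x -> fct (f x) = fct x.

Definition good_tower (X : tower R) :=
  forall N, stage_map (@step R X N) /\ fct_map (@step R X N).

(** Flat means here that the function is zero, in which case vanishing cycle cohomology is ordinary
    cohomology; this is unrelated to the flats of the arrangement. *)
Definition flat_tower (X : tower R) := forall N x, @fct R X N x = 0.

Definition tower_map (X Y : tower R) (phi : forall N, space X N -> space Y N) :=
  (forall N, stage_map (phi N)) /\ forall N x, phi N.+1 (step x) = step (phi N x).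

Definition bounded_cochain (X : tower R) (c : cochain X) :=
  exists m, forall s, (m <= sdim s)%N -> c s = 0.

(* In the abs_ versions the pair (U, U n {Re f > 0}) is replaced by the whole *)
(* of [dom X N]: they are what the cochains acting by cup product satisfy.    *)
Definition cocycle_at (X : tower R) N (c : cochain X) :=
  exists U : set (space X N),
    [/\ fct_nbhd U, zero_on U (cobound c) & zero_on (U `&` @fct_pos R X N) c].

Definition abs_cocycle_at (X : tower R) N (c : cochain X) :=
  zero_on (dom X N) (cobound c).

Definition abs_exact_at (X : tower R) N (c : cochain X) :=
  exists b, zero_on (dom X N) (c - cobound b).

Definition abs_cocycle (X : tower R) (c : cochain X) :=
  [/\ bounded_cochain c, forall N, abs_cocycle_at N c
    & forall N, abs_exact_at N (restr c - c)].

Section OneTower.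
Variable X : tower R.
Implicit Types (a b c h : cochain X).

Lemma cocycleE c : is_cocycle c <->
  [/\ bounded_cochain c, forall N, cocycle_at N c
    & forall N, exact_at N (restr c - c)].
Proof. by []. Qed.

Lemma sing_face N j k (U : set (space X N)) (sg : simplex R k -> space X N)
    (v : 'I_j.+1 -> 'I_k.+1) : sing U sg -> sing U (sg \o push v).
Proof.
move=> [csg sgU]; split=> [t|_ [t _ <-]]; last by apply: sgU; exists (push v t).
by apply: continuous_comp; [exact: push_continuous|exact: csg].
Qed.

Lemma zero_on_cupl N (U : set (space X N)) a b :
  zero_on U a -> zero_on U (cup a b).
Proof.
move=> a0 k sg sgU /=; apply: big1 => i _.
by rewrite a0 ?mul0r//; exact: sing_face.
Qed.

Lemma zero_on_cupr N (U : set (space X N)) a b :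
  zero_on U b -> zero_on U (cup a b).
Proof.
move=> b0 k sg sgU /=; apply: big1 => i _.
by rewrite b0 ?mulr0//; exact: sing_face.
Qed.

Lemma zero_on_sgnc N (U : set (space X N)) c : zero_on U c -> zero_on U (sgnc c).
Proof. by move=> c0 k sg sgU; rewrite /sgnc c0// mulr0. Qed.

Lemma zero_onN N (U : set (space X N)) c : zero_on U c -> zero_on U (- c).
Proof. by move=> c0 k sg sgU; rewrite fctE c0// oppr0. Qed.

Lemma zero_onD N (U : set (space X N)) a b :
  zero_on U a -> zero_on U b -> zero_on U (a + b).
Proof. by move=> a0 b0; rewrite -[b]opprK; apply/zero_onB/zero_onN. Qed.

Lemma exact_atD N a b : exact_at N a -> exact_at N b -> exact_at N (a + b).
Proof.
move=> ea eb; rewrite -[b]opprK; apply: exact_atB => //.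
by rewrite -sub0r; apply: exact_atB => //; exact: exact_at0.
Qed.

Lemma fct_nbhd_dom N (U : set (space X N)) : fct_nbhd U -> U `<=` dom X N.
Proof. by move=> [[W _ ->] _] x []. Qed.

(** A cup product vanishes wherever one factor does, so [cup a h] inherits from [h] the vanishing on
    the positive part. *)
Lemma cocycle_at_cup N a h :
  abs_cocycle_at N a -> cocycle_at N h -> cocycle_at N (cup a h).
Proof.
move=> da [U [nU dh h0]]; exists U; split=> //; last exact: zero_on_cupr.
rewrite cobound_cup; apply: zero_onD; last exact: zero_on_cupr.
apply: zero_on_cupl; apply: zero_on_sub da; exact: fct_nbhd_dom.
Qed.

(** If [b] is a primitive of [h], then [cup (sgnc a) b] is one of [cup a h]: the sign in the Leibniz
    rule cancels that of [sgnc]. *)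
Lemma exact_at_cupr N a h :
  abs_cocycle_at N a -> exact_at N h -> exact_at N (cup a h).
Proof.
move=> da [b [U [nU b0 hb]]]; exists (cup (sgnc a) b), U; split=> //.
  exact: zero_on_cupr.
have -> : cup a h - cobound (cup (sgnc a) b) =
    cup a (h - cobound b) - cup (cobound (sgnc a)) b.
  rewrite cobound_cup cupBr (_ : sgnc (sgnc a) = a) ?opprD ?addrA 1?addrAC//.
  apply/funext => s; rewrite /sgnc mulrA -expr2 -exprM mulnC exprM sqrrN.
  by rewrite !expr1n mul1r.
apply: zero_onB; first exact: zero_on_cupr.
apply: zero_on_cupl; rewrite cobound_sgnc; apply/zero_onN/zero_on_sgnc.
by apply: zero_on_sub da; exact: fct_nbhd_dom.
Qed.

(** If [b] is a primitive of [a], then [cup b h] is one of [cup a h]; it vanishes on the positive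
    part because [h] does. *)
Lemma exact_at_cupl N a h :
  abs_exact_at N a -> cocycle_at N h -> exact_at N (cup a h).
Proof.
move=> [b ab] [U [nU dh h0]]; exists (cup b h), U; split=> //.
  exact: zero_on_cupr.
have -> : cup a h - cobound (cup b h) =
    cup (a - cobound b) h - cup (sgnc b) (cobound h).
  by rewrite cobound_cup cupBl opprD addrA.
apply: zero_onB; last exact: zero_on_cupr.
by apply: zero_on_cupl; apply: zero_on_sub ab; exact: fct_nbhd_dom.
Qed.

Hypothesis flX : flat_tower X.

Lemma flat_nbhd N (U : set (space X N)) : fct_nbhd U -> U = dom X N.
Proof.
move=> nU; apply/seteqP; split; first exact: fct_nbhd_dom.
by case: nU => _ Uf x Xx; apply: Uf; split=> //=; exact: flX.
Qed.

(** The set where the real part of the function is positive is empty, whereas a simplex has at least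
    a vertex. *)
Lemma zero_on_pos N c : zero_on (@fct_pos R X N) c.
Proof.
move=> k sg [_ sgp].
have t0 : @simplex_set R k (\row_j (j == 0)%:R).
  split=> [i|]; first by rewrite mxE ler0n.
  rewrite (bigD1 ord0)//= mxE eqxx big1 ?addr0// => i /negPf i0.
  by rewrite mxE i0.
have : @fct_pos R X N (sg (SigSub (mem_set t0))).
  by apply: sgp; exists (SigSub (mem_set t0)).
by rewrite /fct_pos /= flX /= ltxx.
Qed.

Lemma flat_cocycle_at N c : cocycle_at N c <-> abs_cocycle_at N c.
Proof.
split=> [[U [/flat_nbhd-> //]]|dc].
exists (dom X N); split=> //; first exact: fct_nbhdT.
by apply: zero_on_sub (@zero_on_pos N c) => x [].
Qed.

Lemma flat_exact_at N c : exact_at N c <-> abs_exact_at N c.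
Proof.
split=> [[b [U [/flat_nbhd-> _ ?]]]|[b cb]]; first by exists b.
exists b, (dom X N); split=> //; first exact: fct_nbhdT.
by apply: zero_on_sub (@zero_on_pos N b) => x [].
Qed.

Lemma flat_cocycle c : is_cocycle c <-> abs_cocycle c.
Proof.
split=> [[bc dc ec]|[bc dc ec]]; split=> // N.
- by apply/flat_cocycle_at; exact: dc.
- exact/flat_exact_at.
- by have /flat_cocycle_at := dc N.
- exact/flat_exact_at.
Qed.

End OneTower.

Section Gpull.
Variables (X Y : tower R) (m : nat -> nat).
Variable phi : forall N, space X N -> space Y (m N).
Implicit Types (c b : cochain Y).

Lemma gpullB c b : gpull phi (c - b) = gpull phi c - gpull phi b.
Proof. exact: cochain_eqP. Qed.

Lemma gpull_cobound c : gpull phi (cobound c) = cobound (gpull phi c).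
Proof. by apply: cochain_eqP => N [|k] sg. Qed.

Lemma gpull1 : gpull phi (@cochain1 R Y) = @cochain1 R X.
Proof. exact: cochain_eqP. Qed.

Lemma gpull_bounded c : bounded_cochain c -> bounded_cochain (gpull phi c).
Proof. by move=> [k c0]; exists k => -[N [j sg]] kj; exact: c0. Qed.

Variable N : nat.
Hypothesis phiN : stage_map (@phi N).

Lemma zero_on_gpull (U : set (space X N)) (V : set (space Y (m N))) c :
  (forall x, U x -> V (@phi N x)) -> zero_on V c -> zero_on U (gpull phi c).
Proof.
move=> UV c0 k sg [csg sgU]; apply: c0; split=> [t|_ [t _ <-]].
  by apply: continuous_comp; [exact: csg|exact: phiN.1].
by apply: UV; apply: sgU; exists t.
Qed.

Lemma gpull_abs_cocycle_at c :
  abs_cocycle_at (m N) c -> abs_cocycle_at N (gpull phi c).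
Proof.
move=> dc; rewrite /abs_cocycle_at -gpull_cobound.
by apply: zero_on_gpull dc => x /phiN.2.
Qed.

Lemma gpull_abs_exact_at c : abs_exact_at (m N) c -> abs_exact_at N (gpull phi c).
Proof.
move=> [b cb]; exists (gpull phi b); rewrite -gpull_cobound -gpullB.
by apply: zero_on_gpull cb => x /phiN.2.
Qed.

Hypothesis fphiN : fct_map (@phi N).

Lemma preimage_nbhd (V : set (space Y (m N))) :
  fct_nbhd V -> fct_nbhd (dom X N `&` @phi N @^-1` V).
Proof.
move=> [[W oW VW] fV]; split; last first.
  by move=> x [Xx fx]; split=> //; apply: fV; split; [exact: phiN.2|rewrite /= fphiN].
exists (@phi N @^-1` W); first by move/continuousP: phiN.1; exact.
rewrite VW; apply/seteqP; split=> x; first by move=> [Xx []].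
by move=> [Xx Wx]; split=> //; split=> //; exact: phiN.2.
Qed.

Lemma preimage_pos (V : set (space Y (m N))) x :
  (dom X N `&` @phi N @^-1` V `&` @fct_pos R X N) x ->
  (V `&` @fct_pos R Y (m N)) (@phi N x).
Proof. by move=> [[Xx Vx] px]; split=> //; rewrite /fct_pos /= fphiN. Qed.

Lemma gpull_cocycle_at c : cocycle_at (m N) c -> cocycle_at N (gpull phi c).
Proof.
move=> [V [nV dc c0]]; exists (dom X N `&` @phi N @^-1` V); split.
- exact: preimage_nbhd.
- by rewrite -gpull_cobound; apply: zero_on_gpull dc => x [].
- by apply: zero_on_gpull c0; exact: preimage_pos.
Qed.

Lemma gpull_exact_at c : exact_at (m N) c -> exact_at N (gpull phi c).
Proof.
move=> [b [V [nV b0 cb]]]; exists (gpull phi b), (dom X N `&` @phi N @^-1` V); split.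
- exact: preimage_nbhd.
- by apply: zero_on_gpull b0; exact: preimage_pos.
- by rewrite -gpull_cobound -gpullB; apply: zero_on_gpull cb => x [].
Qed.

End Gpull.

Lemma restrE (X : tower R) (c : cochain X) :
  restr c = gpull (m := succn) (fun N => @step R X N) c.
Proof. exact: cochain_eqP. Qed.

Lemma pullE (X Y : tower R) (phi : forall N, space X N -> space Y N) c :
  pull phi c = gpull (m := id) phi c.
Proof. exact: cochain_eqP. Qed.

Lemma pull_restr (X Y : tower R) (phi : forall N, space X N -> space Y N) c :
  tower_map phi -> pull phi (restr c) = restr (pull phi c).
Proof.
move=> [_ phiS]; apply: cochain_eqP => N k sg /=; congr (c (sx _)).
by apply/funext => t /=; rewrite phiS.
Qed.

Lemma pullB (X Y : tower R) (phi : forall N, space X N -> space Y N) c b :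
  pull phi (c - b) = pull phi c - pull phi b.
Proof. exact: cochain_eqP. Qed.

Lemma pull_cup (X Y : tower R) (phi : forall N, space X N -> space Y N) c b :
  pull phi (cup c b) = cup (pull phi c) (pull phi b).
Proof. exact: cochain_eqP. Qed.

Lemma pull_abs_cocycle (X Y : tower R) (phi : forall N, space X N -> space Y N) c :
  tower_map phi -> abs_cocycle c -> abs_cocycle (pull phi c).
Proof.
move=> phit [bc dc ec]; split=> [|N|N].
- by rewrite pullE; exact: gpull_bounded.
- by rewrite pullE; apply: gpull_abs_cocycle_at => //; exact: phit.1.
- rewrite -pull_restr// -pullB pullE.
  by apply: gpull_abs_exact_at => //; exact: phit.1.
Qed.

Lemma pull_cocycle (X Y : tower R) (phi : forall N, space X N -> space Y N) c :
  tower_map phi -> (forall N, fct_map (phi N)) ->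
  is_cocycle c -> is_cocycle (pull phi c).
Proof.
move=> phit phif [bc dc ec]; apply/cocycleE; split=> [|N|N].
- by rewrite pullE; exact: gpull_bounded.
- by rewrite pullE; apply: gpull_cocycle_at; [exact: phit.1|exact: phif|exact: dc].
- rewrite -pull_restr// -pullB pullE.
  by apply: gpull_exact_at; [exact: phit.1|exact: phif|exact: ec].
Qed.

Lemma cup_cocycle (X : tower R) (a h : cochain X) : good_tower X ->
  abs_cocycle a -> is_cocycle h -> is_cocycle (cup a h).
Proof.
move=> gX [[p bp] da ea] [[q bq] dh eh]; apply/cocycleE; split=> [|N|N].
- by exists (p + q)%N; exact: sdim_cup_ge.
- by apply: cocycle_at_cup => //; exact: dh.
(* Compatibility with the stages is separated into the variation of each factor. *)
- have -> : restr (cup a h) - cup a h =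
      cup (restr a - a) (restr h) + cup a (restr h - h).
    rewrite cupBl cupBr addrA subrK; congr (_ - _); exact: cochain_eqP.
  apply: exact_atD; last exact: exact_at_cupr.
  (* The restriction of [h] is a cocycle at stage [N] because [h] is one at stage [N.+1]. *)
  apply: exact_at_cupl => //; rewrite restrE.
  have [st ft] := gX N.
  by apply: gpull_cocycle_at => //; exact: (dh N.+1).
Qed.

Lemma cochain1_cocycle (X : tower R) : flat_tower X -> is_cocycle (@cochain1 R X).
Proof.
move=> flX; apply/(flat_cocycle flX); split=> [|N|N].
- by exists 1%N => s; rewrite /cochain1; case: (sdim s).
- by rewrite /abs_cocycle_at cobound1.
- exists 0; rewrite cobound0 subr0 restrE gpull1 subrr; exact: zero_on0.
Qed.

End Pulling.

(** * Independence of representatives *)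

Section Classes.
Variable R : realType.

Section OneTower.
Variable X : tower R.
Implicit Types (c b : cochain X) (h : cohom X).

Lemma coh_rep_cocycle h : is_cocycle (coh_rep h).
Proof. by rewrite /coh_rep; case: (repr _) => c /= /asboolP. Qed.

Lemma cls_rep h : cls (coh_rep h) = h.
Proof. by rewrite /cls /coh_rep valKd reprK. Qed.

(** Both cochains must be cocycles, as [cls] sends every other cochain to 0. *)
Lemma cls_eqP c b : is_cocycle c -> is_cocycle b ->
  cls c = cls b <-> is_exact (c - b).
Proof.
move=> cc cb; have cc' : c \in @cocycles R X by apply/asboolP.
have cb' : b \in @cocycles R X by apply/asboolP.
have uc : c = val (Cocycle cc') by []; have vb : b = val (Cocycle cb') by [].
rewrite {1}uc {1}vb /cls !valKd; split=> [/eqP|e].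
  by rewrite -Quotient.idealrBE => /asboolP; rewrite raddfB.
by apply/eqP; rewrite -Quotient.idealrBE; apply/asboolP; rewrite raddfB.
Qed.

Lemma rep_cls c : is_cocycle c -> is_exact (coh_rep (cls c) - c).
Proof.
by move=> cc; apply/cls_eqP => //; [exact: coh_rep_cocycle|rewrite cls_rep].
Qed.

End OneTower.

Section Maps.
Variables (X Y : tower R) (phi : forall N, space X N -> space Y N).
Hypothesis phit : tower_map phi.

Lemma pullback_cls c : (forall N, fct_map (@phi N)) -> is_cocycle c ->
  pullback phi (cls c) = cls (pull phi c).
Proof.
move=> phif cc; apply/cls_eqP; try exact: pull_cocycle.
  by apply: pull_cocycle => //; exact: coh_rep_cocycle.
rewrite -pullB pullE => N; apply: gpull_exact_at => //; first exact: phit.1.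
exact: rep_cls.
Qed.

Hypotheses (gX : good_tower X) (flY : flat_tower Y).

Lemma act_cocycle a h : is_cocycle a -> is_cocycle h ->
  is_cocycle (cup (pull phi a) h).
Proof.
move=> ca ch; apply: cup_cocycle => //; apply: pull_abs_cocycle => //.
exact/flat_cocycle.
Qed.

(** Changing either representative changes the cup product by an exact cochain. Identities of
    cochains, such as associativity, thereby descend to classes. *)
Lemma coh_act_cls a h : is_cocycle a -> is_cocycle h ->
  coh_act phi (cls a) (cls h) = cls (cup (pull phi a) h).
Proof.
move=> ca ch; have cra := coh_rep_cocycle (cls a).
have crh := coh_rep_cocycle (cls h).
apply/cls_eqP; try exact: act_cocycle.
set ra := coh_rep _; set rh := coh_rep _.
have -> : cup (pull phi ra) rh - cup (pull phi a) h =
    cup (pull phi (ra - a)) rh + cup (pull phi a) (rh - h).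
  by rewrite pullB cupBl cupBr addrA subrK.
move=> N; apply: exact_atD.
  apply: exact_at_cupl; last by case: crh => _ /(_ N).
  rewrite pullE; apply: gpull_abs_exact_at; first exact: phit.1.
  exact/flat_exact_at/rep_cls.
apply: exact_at_cupr; last exact: rep_cls.
rewrite pullE; apply: gpull_abs_cocycle_at; first exact: phit.1.
by apply/flat_cocycle_at => //; case: ca => _ /(_ N).
Qed.

End Maps.
End Classes.
(** * The ring structure and its action *)

Section Algebra.
Variable R : realType.

Lemma tower_map_id (X : tower R) : tower_map (fun N => @id (space X N)).
Proof. by split=> // N; split=> // x. Qed.

Lemma flat_fct_map (X Y : tower R) (phi : forall N, space X N -> space Y N) :
  flat_tower X -> flat_tower Y -> forall N, fct_map (phi N).
Proof. by move=> flX flY N x _; rewrite flX flY. Qed.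

Lemma pull_comp (X Y Z : tower R) (phi : forall N, space X N -> space Y N)
    (psi : forall N, space Y N -> space Z N)
    (chi : forall N, space X N -> space Z N) c :
  (forall N x, psi N (phi N x) = chi N x) ->
  pull phi (pull psi c) = pull chi c.
Proof.
move=> e; apply: cochain_eqP => N k sg /=; congr (c (sx _)).
by apply/funext => t /=; rewrite e.
Qed.

Lemma pullback_comp (X Y Z : tower R) (phi : forall N, space X N -> space Y N)
    (psi : forall N, space Y N -> space Z N)
    (chi : forall N, space X N -> space Z N) h :
  tower_map phi -> (forall N, fct_map (phi N)) ->
  tower_map psi -> (forall N, fct_map (psi N)) ->
  (forall N x, psi N (phi N x) = chi N x) ->
  pullback phi (pullback psi h) = pullback chi h.
Proof.
move=> tphi fphi tpsi fpsi e; rewrite -[h]cls_rep.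
have ch := coh_rep_cocycle h.
have tchi : tower_map chi.
  split=> [N|N x]; last by rewrite -!e tphi.2 tpsi.2.
  split=> [|x Xx]; last by rewrite -e; apply: (tpsi.1 N).2; apply: (tphi.1 N).2.
  rewrite (_ : chi N = psi N \o phi N); last by apply/funext => x /=.
  by move=> x; apply: continuous_comp; [exact: (tphi.1 N).1|exact: (tpsi.1 N).1].
have fchi N : fct_map (chi N).
  by move=> x Xx; rewrite -e fpsi ?fphi//; exact: (tphi.1 N).2.
rewrite !pullback_cls//; last exact: pull_cocycle.
by rewrite (pull_comp _ e).
Qed.

Lemma coh_act_mul (X Y : tower R) (phi : forall N, space X N -> space Y N) a b h :
  tower_map phi -> good_tower X -> good_tower Y -> flat_tower Y ->
  coh_act phi (cohom_mul a b) h = coh_act phi a (coh_act phi b h).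
Proof.
move=> tphi gX gY flY; rewrite /cohom_mul.
rewrite -[a]cls_rep -[b]cls_rep -[h]cls_rep.
have ca := coh_rep_cocycle a; have cb := coh_rep_cocycle b.
have ch := coh_rep_cocycle h; have tid := tower_map_id Y.
rewrite !coh_act_cls//; try exact: act_cocycle.
by rewrite pull_cup cup_assoc.
Qed.

Lemma coh_act1 (X Y : tower R) (phi : forall N, space X N -> space Y N) h :
  tower_map phi -> good_tower X -> flat_tower Y ->
  coh_act phi (cohom1 Y) h = h.
Proof.
move=> tphi gX flY; rewrite /cohom1 -[h]cls_rep.
rewrite coh_act_cls//; [|exact: cochain1_cocycle|exact: coh_rep_cocycle].
by rewrite pullE gpull1 cup1c.
Qed.

(** Semilinearity over a commutative square: pullback commutes with cup products already on
    cochains. *)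
Lemma pullback_act (X Y X' Y' : tower R) (phi : forall N, space X N -> space Y N)
    (phi' : forall N, space X' N -> space Y' N)
    (psi : forall N, space X' N -> space X N)
    (psi0 : forall N, space Y' N -> space Y N) a h :
  tower_map phi -> tower_map phi' -> tower_map psi -> tower_map psi0 ->
  (forall N, fct_map (psi N)) ->
  good_tower X -> good_tower X' -> flat_tower Y -> flat_tower Y' ->
  (forall N x, phi N (psi N x) = psi0 N (phi' N x)) ->
  pullback psi (coh_act phi a h) =
  coh_act phi' (pullback psi0 a) (pullback psi h).
Proof.
move=> tphi tphi' tpsi tpsi0 fpsi gX gX' flY flY' e.
rewrite -[a]cls_rep -[h]cls_rep.
have ca := coh_rep_cocycle a; have ch := coh_rep_cocycle h.
have fpsi0 := flat_fct_map psi0 flY' flY.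
rewrite coh_act_cls// !pullback_cls//; last exact: act_cocycle.
rewrite coh_act_cls//; try exact: pull_cocycle.
by rewrite pull_cup (pull_comp _ e) (pull_comp (chi := fun N x => psi0 N (phi' N x))).
Qed.

Section Flat.
Variable X : tower R.
Hypotheses (gX : good_tower X) (flX : flat_tower X).
Local Notation mul := (@cohom_mul R X).
Local Notation one := (@cohom1 R X).

Lemma cohom_mulA : associative mul.
Proof. by move=> a b c; apply/esym/coh_act_mul => //; exact: tower_map_id. Qed.

Lemma cohom_mul1 : left_id one mul.
Proof. by move=> a; apply: coh_act1 => //; exact: tower_map_id. Qed.

Lemma cohom_mulr1 : right_id one mul.
Proof.
move=> a; rewrite /cohom_mul /cohom1 -[a]cls_rep.
have tid := tower_map_id X.
rewrite coh_act_cls//; [|exact: coh_rep_cocycle|exact: cochain1_cocycle].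
by rewrite cupc1; congr cls; exact: cochain_eqP.
Qed.

Definition degree2 (h : cohom X) := exists2 c : cochain X,
  is_cocycle c /\ (forall s, sdim s != 2%N -> c s = 0) & h = cls c.

Lemma degree2_mulC g h : degree2 g -> degree2 h -> mul g h = mul h g.
Proof.
move=> [c [cc c2] ->] [b [cb b2] ->].
have tid := tower_map_id X; rewrite /cohom_mul !coh_act_cls//.
have idE a : pull (X := X) (Y := X) (fun N => id) a = a by exact: cochain_eqP.
rewrite !idE; apply/cls_eqP.
- by rewrite -[c]idE; exact: act_cocycle.
- by rewrite -[b]idE; exact: act_cocycle.
(* The coboundary of [cup1 b c] is the difference of the two orders. The cocycle identities hold on
   all vertex lists because every face of the simplex stays in the domain. *)
move=> N; apply/flat_exact_at => //; exists (cup1 b c) => k sg sgX.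
rewrite [X in X = _](_ : _ = (cup c b - cup b c) (sx sg) -
  cobound (cup1 b c) (sx sg))//.
have dl a : is_cocycle a -> forall s, dlist (ev a sg) s = 0.
  move=> /flat_cocycle[]// _ /(_ N) da _ s.
  rewrite -ev_cobound; case: s => // x t; rewrite /ev da//; exact: sing_face.
by rewrite cobound_cup1 ?subrr//; exact: dl.
Qed.

Inductive degree2_gen : cohom X -> Prop :=
| Degree2_one : degree2_gen one
| Degree2_mul h x of degree2 h & degree2_gen x : degree2_gen (mul h x).

Lemma degree2_genM x y : degree2_gen x -> degree2_gen y -> degree2_gen (mul x y).
Proof.
move=> gx; elim: gx y => [|h {}x dh _ IHx] y gy; first by rewrite cohom_mul1.
by rewrite -cohom_mulA; apply: Degree2_mul => //; exact: IHx.
Qed.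

Lemma degree2_genC x y : degree2_gen x -> degree2_gen y -> mul x y = mul y x.
Proof.
move=> gx; elim: gx y => [|h {}x dh _ IHx] y gy.
  by rewrite cohom_mul1 cohom_mulr1.
rewrite -cohom_mulA IHx// !cohom_mulA; congr (mul _ x).
elim: gy => [|k {}y dk _ IHy]; first by rewrite cohom_mul1 cohom_mulr1.
by rewrite cohom_mulA (degree2_mulC dh dk) -!cohom_mulA IHy.
Qed.

(* Classes of degree two generate a commutative monoid, in which products    *)
(* over unordered finite sets make sense.                                    *)
Record degree2_monoid := Degree2Monoid {
  degree2_val : cohom X ; degree2_valP : degree2_gen degree2_val }.

Lemma degree2_val_inj : injective degree2_val.
Proof.
by move=> [x px] [y py] /= xy; case: _ / xy py => py; congr Degree2Monoid.
Qed.

Definition degree2_mon1 := Degree2Monoid Degree2_one.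
Definition degree2_monM x y :=
  Degree2Monoid (degree2_genM (degree2_valP x) (degree2_valP y)).

Lemma degree2_monA : associative degree2_monM.
Proof. by move=> x y z; apply: degree2_val_inj; exact: cohom_mulA. Qed.

Lemma degree2_monC : commutative degree2_monM.
Proof.
by move=> x y; apply/degree2_val_inj/degree2_genC; exact: degree2_valP.
Qed.

Lemma degree2_mon1M : left_id degree2_mon1 degree2_monM.
Proof. by move=> x; apply: degree2_val_inj; exact: cohom_mul1. Qed.

HB.instance Definition _ := Monoid.isComLaw.Build degree2_monoid degree2_mon1
  degree2_monM degree2_monA degree2_monC degree2_mon1M.

Lemma degree2_fsbig (I : choiceType) (A : set I) (f : I -> degree2_monoid) :
  \big[mul/one]_(i \in A) degree2_val (f i) =
  degree2_val (\big[degree2_monM/degree2_mon1]_(i \in A) f i).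
Proof.
rewrite (big_morph degree2_val (op1 := mul) (id1 := one))//.
(* Both products run over the same support, since [degree2_val] is injective. *)
suff -> : finite_support one A (fun i => degree2_val (f i)) =
    finite_support degree2_mon1 A f by [].
have e : (fun i => degree2_val (f i)) @^-1` [set~ one] =
    f @^-1` [set~ degree2_mon1].
  apply/seteqP; split=> i /=; first by move=> fi e; apply: fi; rewrite e.
  by move=> fi e; apply: fi; exact: degree2_val_inj.
by rewrite /finite_support !unlock e.
Qed.

(** [E] has to be the disjoint union of [A] and [B] only where [f] is not 1, that is, for Euler
    classes, at weights of nonzero multiplicity. Finiteness of this set keeps the products from
    being the default value 1 given to infinite supports. *)
Lemma degree2_fsbigU (I : choiceType) (A B E : set I) (f : I -> cohom X) :
  (forall i, degree2_gen (f i)) ->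
  finite_set [set i | f i != one] ->
  (forall i, f i != one -> E i <-> A i \/ B i) ->
  (forall i, f i != one -> A i -> ~ B i) ->
  \big[mul/one]_(i \in E) f i =
  mul (\big[mul/one]_(i \in A) f i) (\big[mul/one]_(i \in B) f i).
Proof.
move=> gf finf EAB AB.
pose g i := Degree2Monoid (gf i); set S := [set i | f i != one] in finf.
(* Cutting the index sets down to the support makes them finite and disjoint. *)
have supp D : \big[degree2_monM/degree2_mon1]_(i \in D) g i =
    \big[degree2_monM/degree2_mon1]_(i \in D `&` S) g i.
  symmetry; apply: fsbig_widen => [i []//|i [Di /not_andP[//|/negP]]].
  by rewrite negbK => /eqP fi; apply: degree2_val_inj.
rewrite (degree2_fsbig E g) (degree2_fsbig A g) (degree2_fsbig B g).
suff -> : \big[degree2_monM/degree2_mon1]_(i \in E) g i =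
    degree2_monM (\big[degree2_monM/degree2_mon1]_(i \in A) g i)
      (\big[degree2_monM/degree2_mon1]_(i \in B) g i) by [].
rewrite (supp E) (supp A) (supp B) -fsbigU0; [|exact: finite_setIr|exact: finite_setIr|].
  apply: eq_fsbigl; apply/seteqP; split=> i.
    by move=> [Ei Si]; have [] := (EAB i Si).1 Ei; [left|right].
  by move=> [[Ai Si]|[Bi Si]]; split=> //; apply/(EAB i Si); [left|right].
by move=> i [[Ai Si] [Bi _]]; exact: (AB i Si).
Qed.

Lemma degree2_gen_fsbig (I : choiceType) (A : set I) (f : I -> cohom X) :
  (forall i, degree2_gen (f i)) -> degree2_gen (\big[mul/one]_(i \in A) f i).
Proof.
move=> gf; rewrite (degree2_fsbig A (fun i => Degree2Monoid (gf i))).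
exact: degree2_valP.
Qed.

End Flat.

Lemma pullback_mul (X Y : tower R) (psi : forall N, space X N -> space Y N) a b :
  tower_map psi -> good_tower X -> flat_tower X -> good_tower Y -> flat_tower Y ->
  pullback psi (cohom_mul a b) = cohom_mul (pullback psi a) (pullback psi b).
Proof.
move=> tpsi gX flX gY flY; apply: pullback_act => //.
- exact: tower_map_id.
- exact: tower_map_id.
- exact: flat_fct_map.
Qed.

End Algebra.
(** * Borel constructions *)

Lemma continuous_cst (T U : topologicalType) (u : U) : continuous (fun _ : T => u).
Proof. by move=> x; exact: cvg_cst. Qed.

Lemma pair_map_continuous (T T' U U' : topologicalType) (f : T -> T') (g : U -> U') :
  continuous f -> continuous g -> continuous (fun p : T * U => (f p.1, g p.2)).
Proof.
move=> fc gc p; apply: cvg_pair.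
  by apply: (continuous_comp (f := fst)); [exact: cvg_fst|exact: fc].
by apply: (continuous_comp (f := snd)); [exact: cvg_snd|exact: gc].
Qed.

Lemma col_mx_continuous (T : topologicalType) m N (z : 'rV[T]_m) :
  continuous (fun A : 'M[T]_(N, m) => (col_mx z A : 'M[T]_(N.+1, m))).
Proof.
apply: mx_continuous => i j.
rewrite -(splitK (m := 1) i); case: (fintype.split _) => k /=.
  rewrite (_ : (fun _ => _) = fun=> z k j); first exact: continuous_cst.
  by apply/funext => A; rewrite (col_mxEu z).
move=> A B AB; exists (fun a b => if (a == k) && (b == j) then B else setT).
  move=> a b; case: ifP => [/andP[/eqP-> /eqP->]|_]; last exact: filterT.
  by move: AB; rewrite (col_mxEd z).
by move=> A' /(_ k j); rewrite !eqxx /= (col_mxEd z).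
Qed.

Section BorelMaps.
Variables (R : realType) (n s : nat).
Local Notation C := (Cplx R).
Local Notation acting := (acting R n s).
Local Notation fpoint := (fpoint R n s).

(** The group axioms are imposed on the effect on points, which is what orbits depend on, with an
    element of [K] that serves all stages [N] at once. *)
Definition action_group d (K : set (acting d)) :=
  [/\ exists2 k, K k & forall N (p : fpoint d N), kact k p = p,
      forall k k', K k -> K k' -> exists2 k2, K k2 &
        forall N (p : fpoint d N), kact k (kact k' p) = kact k2 p
    & forall k, K k -> exists2 k', K k' &
        forall N (p : fpoint d N), kact k' (kact k p) = p].

Definition equivariant d d' (K : set (acting d)) (K' : set (acting d'))
    (h : 'cV[C]_d -> 'cV[C]_d') :=
  forall k, K k -> exists2 k', K' k' & forall N (p : fpoint d N),
    (h (kact k p).1, (kact k p).2) = kact k' ((h p.1, p.2) : fpoint d' N).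

Section Orbits.
Variables (d : nat) (K : set (acting d)).
Hypothesis Kg : action_group K.

Lemma korbit_act N k (p : fpoint d N) : K k -> korbit K (kact k p) = korbit K p.
Proof.
move=> Kk; have [_ mulK invK] := Kg; apply/seteqP; split=> _ [k' Kk' <-].
  by have [k2 Kk2 e] := mulK _ _ Kk' Kk; exists k2; rewrite ?e.
have [ki Kki ei] := invK _ Kk; have [k2 Kk2 e] := mulK _ _ Kk' Kki.
by exists k2; rewrite // -e ei.
Qed.

Lemma oclass_eqP N (p q : fpoint d N) :
  oclass K p = oclass K q <-> exists2 k, K k & q = kact k p.
Proof.
split=> [/eqmodP/asboolP pq|[k Kk ->]]; last first.
  by apply/eqmodP/asboolP; rewrite korbit_act.
have [[k1 Kk1 e1] _ _] := Kg; have : korbit K q q by exists k1; rewrite ?e1.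
by rewrite -pq => -[k Kk <-]; exists k.
Qed.

Lemma orepr_oclass N (p : fpoint d N) : exists2 k, K k & p = kact k (orepr (oclass K p)).
Proof. by apply/oclass_eqP; rewrite /oclass /orepr reprK. Qed.

Lemma oclassP N (x : orbits K N) : exists p, x = oclass K p.
Proof. by exists (orepr x); rewrite /oclass /orepr reprK. Qed.

Lemma oclass_continuous N : continuous (@oclass R n s d K N).
Proof. exact: pi_continuous. Qed.

Lemma orbits_continuous N (Z : topologicalType) (f : orbits K N -> Z) :
  continuous (f \o @oclass R n s d K N) -> continuous f.
Proof. by move=> fc; apply/quotient_continuous. Qed.

Variables (W : set 'cV[C]_d) (f : 'cV[C]_d -> C).
Hypothesis fK : forall k v, K k -> f (k.2 *m v) = f v.
Local Notation X := (borel K W f).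

(** Invariance of [f] under [K] removes the choice of a representative made in [borel]. *)
Lemma fct_oclass N (p : fpoint d N) : @fct R X N (oclass K p) = f p.1.
Proof. by rewrite /= ; have [k Kk {2}->] := orepr_oclass p; rewrite /= fK. Qed.

Definition pad N (p : fpoint d N) : fpoint d N.+1 :=
  (p.1, (col_mx (0 : 'rV_n) p.2.1, col_mx (0 : 'rV_s) p.2.2)).

(** Adding a zero row commutes with the group, which acts on frames by multiplication on the
    right. *)
Lemma step_oclass N (p : fpoint d N) : @step R X N (oclass K p) = oclass K (pad p).
Proof.
apply/oclass_eqP; have [k Kk pk] := orepr_oclass p; exists k => //.
have [e1 [e2 e3]] : p.1 = (kact k (orepr (oclass K p))).1 /\
    p.2.1 = (kact k (orepr (oclass K p))).2.1 /\
    p.2.2 = (kact k (orepr (oclass K p))).2.2 by rewrite -pk.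
rewrite /pad /kact /= in e1 e2 e3 *; congr (_, (_, _)) => //.
  by rewrite (mul_col_mx (0 : 'rV_n)) mul0mx -e2.
by rewrite (mul_col_mx (0 : 'rV_s)) mul0mx -e3.
Qed.

Lemma pad_continuous N : continuous (@pad N).
Proof.
have col0 m : continuous (fun A : 'M[C]_(N, m) =>
    (col_mx (0 : 'rV[C]_m) A : 'M[C]_(N.+1, m))).
  exact: col_mx_continuous.
have idc : continuous (@id 'cV[C]_d) by move=> v; exact: cvg_id.
exact: (pair_map_continuous idc (pair_map_continuous (@col0 n) (@col0 s))).
Qed.

Lemma borel_good : good_tower X.
Proof.
move=> N; split.
  split; last first.
    move=> _ [p [Wp [rp cp]] <-]; rewrite step_oclass; exists (pad p) => //.
    split=> //; split=> [|j].
      by apply: etrans rp; exact: (@rank_col_0mx C N n 1 p.2.1).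
    apply: contraNneq (cp j) => e; apply/eqP/colP => i; rewrite !mxE.
    move/colP: e => /(_ (rshift 1 i)); rewrite [LHS]mxE [RHS]mxE => <-.
    by rewrite /pad /= (col_mxEd (0 : 'rV[C]_s)).
  (* Continuity on the quotient is tested after composition with the projection. *)
  apply: orbits_continuous.
  rewrite (_ : _ \o _ = @oclass R n s d K N.+1 \o @pad N); last first.
    by apply/funext => p /=; exact: step_oclass.
  move=> p; apply: continuous_comp; [exact: pad_continuous|exact: oclass_continuous].
by move=> _ [p _ <-]; rewrite step_oclass !fct_oclass.
Qed.

End Orbits.

Section Induced.
Variables (d d' : nat) (K : set (acting d)) (K' : set (acting d')).
Variables (W : set 'cV[C]_d) (W' : set 'cV[C]_d').
Variables (f : 'cV[C]_d -> C) (f' : 'cV[C]_d' -> C).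
Variable h : 'cV[C]_d -> 'cV[C]_d'.
Hypotheses (Kg : action_group K) (Kg' : action_group K').
Hypothesis hK : equivariant K K' h.

Lemma induced_oclass N (p : fpoint d N) :
  induced K' h (oclass K p) = oclass K' ((h p.1, p.2) : fpoint d' N).
Proof.
have [k Kk pk] := orepr_oclass Kg p; have [k' Kk' e] := hK Kk.
by apply/oclass_eqP => //; exists k' => //; rewrite -e -pk.
Qed.

Lemma induced_tower_map : continuous h -> (forall v, W v -> W' (h v)) ->
  tower_map (X := borel K W f) (Y := borel K' W' f') (@induced R n s d d' K K' h).
Proof.
move=> hc hW; split=> [N|N x]; last first.
  have [p ->] := oclassP x.
  by rewrite step_oclass// !induced_oclass step_oclass.
split; last first.
  move=> _ [p [Wp fp] <-]; rewrite induced_oclass.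
  by exists ((h p.1, p.2) : fpoint d' N) => //; split=> //; exact: hW.
apply: orbits_continuous.
rewrite (_ : _ \o _ = @oclass R n s d' K' N \o
  (fun p : fpoint d N => (h p.1, p.2) : fpoint d' N)).
  move=> p; apply: continuous_comp; last exact: oclass_continuous.
  apply: (pair_map_continuous (f := h) (g := id)) => // v; exact: cvg_id.
by apply/funext => p /=; exact: induced_oclass.
Qed.

End Induced.
End BorelMaps.

(** * Matrix groups acting through homomorphisms *)

Lemma invmxM (F : fieldType) n (g h : 'M[F]_n) :
  g \in unitmx -> h \in unitmx -> invmx (g *m h) = invmx h *m invmx g.
Proof.
move=> ug uh; have ugh : g *m h \in unitmx by rewrite unitmx_mul ug.
apply: (can_inj (mulKmx ugh)).
by rewrite mulmxV// mulmxA -(mulmxA g) mulmxV// mulmx1 mulmxV.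
Qed.

Lemma mulmx_swap (F : pzRingType) n (a b c e : 'M[F]_n) :
  b *m c = c *m b -> (a *m b) *m (c *m e) = (a *m c) *m (b *m e).
Proof. by move=> bc; rewrite !mulmxA -(mulmxA a) bc !mulmxA. Qed.

Section Actions.
Variables (R : realType) (n s : nat).
Local Notation C := (Cplx R).
Implicit Types L : set 'M[C]_n.

Definition matrix_group (L : set 'M[C]_n) :=
  [/\ L `<=` [set g | g \in unitmx], L 1%:M,
      forall g h, L g -> L h -> L (g *m h)
    & forall g, L g -> L (invmx g)].

Definition tmul (t u : 'rV[C]_s) := \row_j (t 0 j * u 0 j).
Definition tinv (t : 'rV[C]_s) := \row_j (t 0 j)^-1.

Lemma torusM t u : torus t -> torus u -> torus (tmul t u).
Proof. by move=> t0 u0 j; rewrite mxE mulf_neq0. Qed.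

Lemma torusV t : torus t -> torus (tinv t).
Proof. by move=> t0 j; rewrite mxE invr_eq0. Qed.

Lemma torus1 : torus (const_mx 1 : 'rV[C]_s).
Proof. by move=> j; rewrite mxE oner_eq0. Qed.

Lemma tinvK t : torus t -> tmul (tinv t) t = const_mx 1.
Proof. by move=> t0; apply/rowP => j; rewrite !mxE mulVf. Qed.

Lemma kactM d N (g g' : 'M[C]_n) (t t' : 'rV[C]_s) (a a' : 'M[C]_d)
    (p : fpoint R n s d N) :
  g \in unitmx -> g' \in unitmx ->
  kact (g, t, a) (kact (g', t', a') p) = kact (g *m g', tmul t t', a *m a') p.
Proof.
move=> ug ug'; rewrite /kact /= invmxM// !mulmxA; congr (_, (_, _)).
apply/matrixP => i j; rewrite !mul_mx_diag !mxE -mulrA; congr (_ * _).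
by rewrite mulrC invfM.
Qed.

Lemma kact1 d N (p : fpoint R n s d N) : kact (1%:M, const_mx 1, 1%:M) p = p.
Proof.
case: p => v [A B]; rewrite /kact /= invmx1 mul1mx mulmx1.
congr (_, (_, _)); apply/matrixP => i j.
by rewrite mul_mx_diag !mxE invr1 mulr1.
Qed.

(** The graph of a homomorphism acts as a group. This covers the classifying spaces, where the space
    acted on is 0, and the stacks V^l / (G^l x T'). *)
Lemma graph_action_group d (L : set 'M[C]_n) (K : set (acting R n s d))
    (a : 'M[C]_n -> 'rV[C]_s -> 'M[C]_d) :
  matrix_group L ->
  (forall k, K k <-> [/\ L k.1.1, torus k.1.2 & k.2 = a k.1.1 k.1.2]) ->
  a 1%:M (const_mx 1) = 1%:M ->
  (forall g g' t t', L g -> L g' -> torus t -> torus t' ->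
     a (g *m g') (tmul t t') = a g t *m a g' t') ->
  action_group K.
Proof.
move=> [Lu L1 LM LV] KP a1 aM.
have KM g t g' t' : L g -> torus t -> L g' -> torus t' ->
    K (g *m g', tmul t t', a g t *m a g' t').
  by move=> *; apply/KP; split=> /=; [exact: LM|exact: torusM|rewrite aM].
split.
- exists (1%:M, const_mx 1, 1%:M); last exact: kact1.
  by apply/KP; split=> //; exact: torus1.
- move=> [[g t] b] [[g' t'] b'] /KP[/= Lg tt ->] /KP[/= Lg' tt' ->].
  exists (g *m g', tmul t t', a g t *m a g' t'); first exact: KM.
  by move=> N p; rewrite kactM//; exact: Lu.
- move=> [[g t] b] /KP[/= Lg tt ->].
  exists (invmx g, tinv t, a (invmx g) (tinv t)).
    by apply/KP; split=> //=; [exact: LV|exact: torusV].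
  move=> N p; rewrite kactM; [|exact/Lu/LV|exact: Lu].
  rewrite -aM//; [|exact: LV|exact: torusV].
  by rewrite mulVmx ?tinvK ?a1 ?kact1//; exact: Lu.
Qed.

Definition classifying_acting (L : set 'M[C]_n) : set (acting R n s 0) :=
  [set k | L k.1.1 /\ torus k.1.2].

Lemma classifying_action_group L : matrix_group L -> action_group (classifying_acting L).
Proof.
move=> Lg; apply: (graph_action_group (a := fun _ _ => 1%:M)) Lg _ _ _ => //.
- move=> k; split=> [[Lk tk]|[Lk tk _]]; last by split.
  by split=> //; rewrite [LHS]flatmx0 [RHS]flatmx0.
- by move=> *; rewrite mulmx1.
Qed.

Lemma classifying_good L : matrix_group L -> good_tower (classifying s L).
Proof. by move=> Lg; apply: borel_good => //; exact: classifying_action_group. Qed.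

Lemma equivariant_graph d (K : set (acting R n s d)) L' :
  (forall k, K k -> L' k.1.1 /\ torus k.1.2) ->
  equivariant K (classifying_acting L') (fun=> 0).
Proof.
move=> KL k Kk; exists (k.1, (0 : 'M[C]_0)); first exact: KL.
by move=> N p; rewrite /kact /= ; rewrite mul0mx.
Qed.

Lemma equivariant_classifying L L' : L `<=` L' ->
  equivariant (classifying_acting L) (classifying_acting L') id.
Proof.
by move=> LL' k [Lk tk]; exists k => //; split=> //; exact: LL'.
Qed.

End Actions.

(** * The towers of a setup and the maps between them *)

Section SetupTowers.
Variables (R : realType) (n d r s : nat) (D : setup R n d r s).
Hypothesis hD : admissible D.
Local Notation C := (Cplx R).
Implicit Types l : 'rV[int]_r.

Lemma grpG_group : matrix_group (grpG D).
Proof.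
have [[[[[I IG GE] G1 GM GV] _ _] _ _ _] _] := hD.
by split=> // g; rewrite GE => -[].
Qed.

Lemma tauM t u : torus t -> torus u -> tau D (tmul t u) = tau D t *m tau D u.
Proof. by have [[_ [[[_ _ tM] _ _] _] _ _] _] := hD; exact: tM. Qed.

Lemma tau1 : tau D (const_mx 1) = 1%:M.
Proof. by have [[_ [[[_ t1 _] _ _] _] _ _] _] := hD. Qed.

Lemma tau_grpG t : torus t -> grpG D (tau D t).
Proof. by have [[_ [[_ _ tG] _] _ _] _] := hD => tt; apply: tG; exists t. Qed.

Lemma tau_comm t u : torus t -> torus u -> tau D t *m tau D u = tau D u *m tau D t.
Proof.
by move=> tt tu; rewrite -!tauM//; congr tau; apply/rowP => j; rewrite !mxE mulrC.
Qed.

Lemma torus_cochar l (z : C) : z != 0 -> torus (cochar_eval l z).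
Proof. by move=> z0 j; rewrite mxE expfz_neq0. Qed.

Lemma rhoM g h : grpG D g -> grpG D h -> rho D (g *m h) = rho D g *m rho D h.
Proof. by have [[_ _ [_ _ rM] _] _] := hD; exact: rM. Qed.

Lemma rho1 : rho D 1%:M = 1%:M.
Proof. by have [[_ _ [_ r1 _] _] _] := hD. Qed.

Lemma rho'M t u : torus t -> torus u -> rho' D (tmul t u) = rho' D t *m rho' D u.
Proof. by have [[_ _ _ [_ _ rM]] _] := hD; exact: rM. Qed.

Lemma rho'1 : rho' D (const_mx 1) = 1%:M.
Proof. by have [[_ _ _ [_ r1 _]] _] := hD. Qed.

Lemma rho_rho' g t : grpG D g -> torus t -> rho D g *m rho' D t = rho' D t *m rho D g.
Proof. by have [_ [c _ _ _]] := hD; exact: c. Qed.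

Lemma pot_inv g t v : grpG D g -> torus t -> pot D (rho D g *m rho' D t *m v) = pot D v.
Proof. by have [_ [_ _ pG pT]] := hD => Gg tt; rewrite -mulmxA pG// pT. Qed.

Lemma centralizer_group l : matrix_group (centralizer D l).
Proof.
have [Gu G1 GM GV] := grpG_group; split.
- by move=> g [/Gu].
- by split=> // z z0; rewrite mul1mx mulmx1.
- move=> g h [Gg gc] [Gh hc]; split=> [|z z0]; first exact: GM.
  by rewrite -mulmxA hc// mulmxA gc// -mulmxA.
- move=> g [Gg gc]; split=> [|z z0]; first exact: GV.
  have ug := Gu _ Gg; apply: (can_inj (mulKmx ug)); rewrite mulKVmx//.
  by rewrite mulmxA gc// -mulmxA mulmxV// mulmx1.
Qed.

Lemma image_torus_group : matrix_group (tau D @` @torus R r).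
Proof.
have [Gu G1 GM GV] := grpG_group; split.
- by move=> _ [t tt <-]; exact/Gu/tau_grpG.
- by exists (const_mx 1); [exact: torus1|exact: tau1].
- move=> _ _ [t tt <-] [u tu <-]; exists (tmul t u); first exact: torusM.
  exact: tauM.
- move=> _ [t tt <-]; exists (tinv t); first exact: torusV.
  have ut := Gu _ (tau_grpG tt); apply: (can_inj (mulmxK ut)).
  by rewrite -tauM ?tinvK ?tau1 ?mulVmx//; exact: torusV.
Qed.

Lemma torus_sub_centralizer l : tau D @` @torus R r `<=` centralizer D l.
Proof.
move=> _ [t tt <-]; split=> [|z z0]; first exact: tau_grpG.
by apply: tau_comm => //; exact: torus_cochar.
Qed.

(** The graph used inside [fixed_stack], named so that lemmas on group actions can refer to it. *)
Definition fixed_acting l : set (acting R n s d) :=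
  [set k | [/\ centralizer D l k.1.1, torus k.1.2
             & k.2 = rho D k.1.1 *m rho' D k.1.2]].

Lemma fixed_action_group l : action_group (fixed_acting l).
Proof.
apply: (graph_action_group (a := fun g t => rho D g *m rho' D t))
  (centralizer_group l) _ _ _ => //.
- by rewrite rho1 rho'1 mulmx1.
- move=> g g' t t' [Gg _] [Gg' _] tt tt'; rewrite (rhoM Gg Gg') (rho'M tt tt').
  exact: mulmx_swap (rho_rho' Gg' tt).
Qed.

Lemma fixed_pot l k v : fixed_acting l k -> pot D (k.2 *m v) = pot D v.
Proof. by move=> [[Gg _] tk ->]; exact: pot_inv. Qed.

Lemma fixed_good l : good_tower (fixed_stack D l).
Proof.
apply: borel_good; first exact: fixed_action_group.
by move=> k v; exact: fixed_pot.
Qed.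

Lemma BG_good l : good_tower (BG D l).
Proof. exact/classifying_good/centralizer_group. Qed.

Lemma BT_good : good_tower (BT D).
Proof. exact/classifying_good/image_torus_group. Qed.

(** The next four families are the maps underlying [to_BT], [to_BG], [eu_act] and [istar], in this
    order. *)
Definition BTG_map l : forall N, space (BT D) N -> space (BG D l) N :=
  @induced R n s 0 0 _ _ id.

Definition BGG_map l l' : forall N, space (BG D l') N -> space (BG D l) N :=
  @induced R n s 0 0 _ _ id.

Definition fixedG_map l : forall N, space (fixed_stack D l) N -> space (BG D l) N :=
  @induced R n s d 0 _ _ (fun=> 0).

Definition fixed_map l l' :
    forall N, space (fixed_stack D l') N -> space (fixed_stack D l) N :=
  @induced R n s d d _ _ id.

Arguments BTG_map l [N] x.
Arguments BGG_map l l' [N] x.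
Arguments fixedG_map l [N] x.
Arguments fixed_map l l' [N] x.

Lemma continuous_idfun (T : topologicalType) : continuous (@id T).
Proof. by move=> x; exact: cvg_id. Qed.

Lemma BTG_tower_map l : tower_map (BTG_map l).
Proof.
apply: induced_tower_map => //.
- exact/classifying_action_group/image_torus_group.
- exact/classifying_action_group/centralizer_group.
- exact/equivariant_classifying/torus_sub_centralizer.
- exact: continuous_idfun.
Qed.

Lemma fixedG_equivariant l :
  equivariant (fixed_acting l) (classifying_acting (centralizer D l)) (fun=> 0).
Proof. by apply: equivariant_graph => k [Lk tk _]. Qed.

Lemma fixedG_tower_map l : tower_map (fixedG_map l).
Proof.
apply: induced_tower_map => //.
- exact: fixed_action_group.
- exact/classifying_action_group/centralizer_group.
- exact: fixedG_equivariant.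
- exact: continuous_cst.
Qed.

Section Inclusion.
Variables l l' : 'rV[int]_r.
Hypothesis ll'G : centralizer D l' `<=` centralizer D l.

Lemma BGG_tower_map : tower_map (BGG_map l l').
Proof.
apply: induced_tower_map => //.
- exact/classifying_action_group/centralizer_group.
- exact/classifying_action_group/centralizer_group.
- exact/equivariant_classifying.
- exact: continuous_idfun.
Qed.

Lemma fixed_equivariant : equivariant (fixed_acting l') (fixed_acting l) id.
Proof.
by move=> k [Lk tk ak]; exists k => //; split=> //; exact: ll'G.
Qed.

Lemma BTG_BGG N x : BGG_map l l' (BTG_map l' (N := N) x) = BTG_map l x.
Proof.
have [p ->] := oclassP x; rewrite /BGG_map /BTG_map.
have gT := @classifying_action_group R n s _ image_torus_group.
have gL l0 := @classifying_action_group R n s _ (centralizer_group l0).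
have eT l0 := @equivariant_classifying R n s _ _ (@torus_sub_centralizer l0).
have eG := @equivariant_classifying R n s _ _ ll'G.
rewrite (induced_oclass gT (gL l') (eT l')) (induced_oclass gT (gL l) (eT l)).
by rewrite (induced_oclass (gL l') (gL l) eG).
Qed.

Hypothesis ll'V : fixed_space D l' `<=` fixed_space D l.

Lemma fixed_tower_map : tower_map (fixed_map l l').
Proof.
apply: induced_tower_map => //.
- exact: fixed_action_group.
- exact: fixed_action_group.
- exact: fixed_equivariant.
- exact: continuous_idfun.
Qed.

Lemma fixed_fct_map N : fct_map (fixed_map l l' (N := N)).
Proof.
move=> x _; have [p ->] := oclassP x; rewrite /fixed_map.
rewrite (induced_oclass (fixed_action_group l') (fixed_action_group l) fixed_equivariant).
have fo l0 := @fct_oclass _ _ _ _ _ (fixed_action_group l0) (fixed_space D l0) _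
  (@fixed_pot l0) N.
exact: (etrans (fo l (p.1, p.2)) (esym (fo l' p))).
Qed.

(** The commutative square behind the semilinearity of [istar]. *)
Lemma fixed_BGG N x :
  fixedG_map l (fixed_map l l' (N := N) x) = BGG_map l l' (fixedG_map l' x).
Proof.
have [p ->] := oclassP x; rewrite /fixedG_map /fixed_map /BGG_map.
have gf := fixed_action_group.
have gl l0 := @classifying_action_group R n s _ (centralizer_group l0).
have eG := @equivariant_classifying R n s _ _ ll'G.
rewrite (induced_oclass (gf l') (gf l) fixed_equivariant).
rewrite (induced_oclass (gf l) (gl l) (@fixedG_equivariant l)).
rewrite (induced_oclass (gf l') (gl l') (@fixedG_equivariant l')).
by rewrite (induced_oclass (gl l') (gl l) eG).
Qed.

End Inclusion.

Lemma fixed_map_comp l l' l'' N x :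
  centralizer D l' `<=` centralizer D l -> centralizer D l'' `<=` centralizer D l' ->
  fixed_map l l' (fixed_map l' l'' (N := N) x) = fixed_map l l'' x.
Proof.
move=> h h'; have [p ->] := oclassP x; rewrite /fixed_map.
have gf := fixed_action_group.
rewrite (induced_oclass (gf l'') (gf l') (fixed_equivariant h')).
rewrite (induced_oclass (gf l') (gf l) (fixed_equivariant h)).
by rewrite (induced_oclass (gf l'') (gf l) (fixed_equivariant (subset_trans h' h))).
Qed.

End SetupTowers.
(** * Weights of torus representations *)

Section TorusRepresentations.
Variables (R : realType) (r : nat).
Local Notation C := (Cplx R).
Implicit Types (a b : 'rV[int]_r) (t u : 'rV[C]_r).

Definition dot a (l : 'rV[int]_r) : int := \sum_j a 0 j * l 0 j.

Lemma char_evalM a t u : char_eval a (tmul t u) = char_eval a t * char_eval a u.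
Proof.
by rewrite /char_eval -big_split /=; apply: eq_bigr => j _; rewrite mxE expfzMl.
Qed.

Lemma char_evalD a b t : torus t -> char_eval (a + b) t = char_eval a t * char_eval b t.
Proof.
move=> t0; rewrite /char_eval -big_split /=; apply: eq_bigr => j _.
by rewrite mxE expfzDr.
Qed.

Lemma char_eval1 a : char_eval a (const_mx 1 : 'rV[C]_r) = 1.
Proof. by rewrite /char_eval big1// => j _; rewrite mxE exp1rz. Qed.

Lemma char_eval0 t : char_eval 0 t = 1.
Proof. by rewrite /char_eval big1// => j _; rewrite mxE expr0z. Qed.

Lemma char_eval_delta j (e : int) t : char_eval (\row_i (e *+ (i == j))) t = t 0 j ^ e.
Proof.
rewrite /char_eval (bigD1 j)//= mxE eqxx big1 ?mulr1// => i /negPf ij.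
by rewrite mxE ij mulr0n expr0z.
Qed.

Lemma char_evalV a t : char_eval a (tinv t) = char_eval (- a) t.
Proof. by apply: eq_bigr => j _; rewrite !mxE exprz_inv. Qed.

(** The number 2 is not a root of unity; this is checked in the rationals. *)
Lemma expr2z_inj : injective (fun m : int => (2 : C) ^ m).
Proof.
move=> m m' /=; rewrite -(ratr_nat C 2) -!fmorphXz => /fmorph_inj.
exact: ieexprIz.
Qed.

Lemma char_eval_cochar a l (z : C) : z != 0 ->
  char_eval a (cochar_eval l z) = z ^ dot a l.
Proof.
move=> z0; rewrite /char_eval /dot.
apply: (big_ind2 (fun x m => x = z ^ m)) => //.
  by move=> x m y p -> ->; rewrite expfzDr.
by move=> j _; rewrite mxE exprz_exp mulrC.
Qed.

Definition coord_pt (j : 'I_r) : 'rV[C]_r := \row_i (if i == j then 2 else 1).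

Lemma torus_coord_pt j : torus (coord_pt j).
Proof. by move=> i; rewrite mxE; case: ifP; rewrite ?pnatr_eq0 ?oner_eq0. Qed.

Lemma char_eval_coord_pt a j : char_eval a (coord_pt j) = 2 ^ a 0 j.
Proof.
rewrite /char_eval (bigD1 j)//= mxE eqxx big1 ?mulr1// => i /negPf ij.
by rewrite mxE ij exp1rz.
Qed.

(* Dedekind's independence of characters. *)
Lemma char_independent (V : lmodType C) (S : seq 'rV[int]_r) (c : 'rV[int]_r -> V) :
  uniq S -> (forall t, torus t -> \sum_(a <- S) char_eval a t *: c a = 0) ->
  forall a, a \in S -> c a = 0.
Proof.
elim: S c => // a0 S IHS c /= /andP[a0S uS] c0.
have cS a : a \in S -> c a = 0.
  move=> aS; have aa0 : a != a0 by apply: contraNneq a0S => <-.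
  have [j aj] : exists j, a 0 j != a0 0 j.
    apply/existsP; apply: contraNT aa0 => /existsPn h.
    by apply/eqP/rowP => j; apply/eqP; have := h j; rewrite negbK.
  set u := coord_pt j; have tu : torus u by exact: torus_coord_pt.
  (* The relation at [tmul t u] minus [char_eval a0 u] times the relation at [t] has no term in
     [a0], and [u] is chosen to separate [a] from [a0]. *)
  suff ind t : torus t ->
      \sum_(b <- S) char_eval b t *: ((char_eval b u - char_eval a0 u) *: c b) = 0.
    have /eqP := IHS _ uS ind _ aS; rewrite scaler_eq0 => /orP[|/eqP//].
    by rewrite !char_eval_coord_pt subr_eq0 => /eqP/expr2z_inj/eqP; rewrite (negPf aj).
  move=> tt; have := c0 _ tt; have := c0 _ (torusM tt tu).
  rewrite !big_cons => /eqP; rewrite addrC addr_eq0 => /eqP E1.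
  move=> /eqP; rewrite addrC addr_eq0 => /eqP E2.
  rewrite [LHS](_ : _ = \sum_(b <- S) char_eval b (tmul t u) *: c b -
      char_eval a0 u *: \sum_(b <- S) char_eval b t *: c b).
    by rewrite E1 E2 char_evalM scalerN scalerA opprK mulrC addNr.
  rewrite scaler_sumr -sumrB; apply: eq_bigr => b _.
  by rewrite char_evalM !scalerA -scalerBl; congr (_ *: _); ring.
move=> a; rewrite inE => /predU1P[->|/cS//].
have := c0 _ (@torus1 R r); rewrite big_cons big1_seq ?addr0 ?char_eval1 ?scale1r//.
by move=> b /= bS; rewrite cS ?scaler0.
Qed.

(** Laurent polynomials with coefficients in [V]. A weight may occur several times in the list;
    [laurent_uniq] collects its terms. *)
Definition laurent (V : lmodType C) (q : 'rV[C]_r -> V) :=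
  exists S : seq ('rV[int]_r * V),
    forall t, torus t -> q t = \sum_(x <- S) char_eval x.1 t *: x.2.

Lemma laurent_eq (V : lmodType C) (q q' : 'rV[C]_r -> V) :
  (forall t, torus t -> q t = q' t) -> laurent q' -> laurent q.
Proof. by move=> e [S qS]; exists S => t tt; rewrite e// qS. Qed.

Lemma laurentD (V : lmodType C) (p q : 'rV[C]_r -> V) :
  laurent p -> laurent q -> laurent (fun t => p t + q t).
Proof.
by move=> [S pS] [S' qS]; exists (S ++ S') => t tt; rewrite big_cat/= -pS// -qS.
Qed.

Lemma laurent_cst (V : lmodType C) (v : V) : laurent (fun=> v).
Proof.
by exists [:: (0, v)] => t tt; rewrite big_seq1 char_eval0 scale1r.
Qed.

Lemma laurent_sum (V : lmodType C) (I : Type) (s : seq I) (q : I -> 'rV[C]_r -> V) :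
  (forall i, laurent (q i)) -> laurent (fun t => \sum_(i <- s) q i t).
Proof.
move=> lq; elim: s => [|i s IHs].
  by apply: laurent_eq (laurent_cst 0) => t _; rewrite big_nil.
by apply: laurent_eq (laurentD (lq i) IHs) => t _; rewrite big_cons.
Qed.

Lemma laurentZ (V : lmodType C) (p : 'rV[C]_r -> C^o) (q : 'rV[C]_r -> V) :
  laurent p -> laurent q -> laurent (fun t => p t *: q t).
Proof.
move=> [S pS] [S' qS]; exists [seq (x.1 + y.1, x.2 *: y.2) | x <- S, y <- S'] => t tt.
rewrite pS// qS// big_allpairs_dep scaler_suml; apply: eq_bigr => x _ /=.
rewrite scaler_sumr; apply: eq_bigr => y _ /=.
by rewrite char_evalD// !scalerA; congr (_ *: _); rewrite /GRing.scale /=; ring.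
Qed.

Lemma laurent_prod (I : Type) (s : seq I) (q : I -> 'rV[C]_r -> C^o) :
  (forall i, laurent (q i)) -> laurent (fun t => \prod_(i <- s) q i t : C^o).
Proof.
move=> lq; elim: s => [|i s IHs].
  by apply: laurent_eq (laurent_cst (1 : C^o)) => t _; rewrite big_nil.
by apply: laurent_eq (laurentZ (lq i) IHs) => t _; rewrite big_cons.
Qed.

Lemma laurent_regular (p : 'rV[C]_r -> C) : regular_torus p -> laurent (p : _ -> C^o).
Proof.
elim=> [q [j [->|->]]|z|p1 p2 _ l1 _ l2|p1 p2 _ l1 _ l2].
- exists [:: (\row_i (1 *+ (i == j)), 1)] => t _.
  by rewrite big_seq1 char_eval_delta expr1z [RHS]mulr1.
- exists [:: (\row_i ((-1) *+ (i == j)), 1)] => t _.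
  by rewrite big_seq1 char_eval_delta [RHS]mulr1 exprN1.
- exact: laurent_cst.
- exact: laurentD.
- exact: laurentZ.
Qed.

Lemma laurent_inv (V : lmodType C) (q : 'rV[C]_r -> V) :
  laurent q -> laurent (fun t => q (tinv t)).
Proof.
move=> [S qS]; exists [seq (- x.1, x.2) | x <- S] => t tt.
rewrite qS ?big_map; last exact: torusV.
by apply: eq_bigr => x _; rewrite char_evalV.
Qed.

Lemma laurent_det m (M : 'rV[C]_r -> 'M[C]_m) :
  (forall i j, laurent (fun t => M t i j : C^o)) ->
  laurent (fun t => \det (M t) : C^o).
Proof.
move=> lM; apply: laurent_sum => sg.
apply: (laurentZ (laurent_cst _)); exact: laurent_prod.
Qed.

Lemma laurent_mx m (M : 'rV[C]_r -> 'M[C]_m) :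
  (forall i j, laurent (fun t => M t i j : C^o)) -> laurent M.
Proof.
move=> lM; apply: (@laurent_eq _ _
  (fun t => \sum_i \sum_j M t i j *: delta_mx i j)) => [t _|].
  exact: matrix_sum_delta.
apply: laurent_sum => i; apply: laurent_sum => j.
by apply: laurentZ; [exact: lM|exact: laurent_cst].
Qed.

Lemma laurent_uniq (V : lmodType C) (q : 'rV[C]_r -> V) : laurent q ->
  exists (S : seq 'rV[int]_r) (c : 'rV[int]_r -> V), uniq S /\
    forall t, torus t -> q t = \sum_(a <- S) char_eval a t *: c a.
Proof.
move=> [S qS]; exists (undup (map fst S)), (fun a => \sum_(x <- S | x.1 == a) x.2).
split=> [|t tt]; first exact: undup_uniq.
rewrite qS//; under [RHS]eq_bigr do rewrite scaler_sumr big_mkcond.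
rewrite exchange_big /= big_seq [RHS]big_seq; apply: eq_bigr => x xS.
rewrite (bigD1_seq x.1) ?undup_uniq ?mem_undup ?map_f//= eqxx big1 ?addr0//.
by move=> a /negPf; rewrite eq_sym => ->.
Qed.

(* The weight decomposition: the coefficients of the Laurent polynomial M    *)
(* are the projections on the weight spaces.                                 *)
Lemma torus_weight_decomposition m (M : 'rV[C]_r -> 'M[C]_m) :
  laurent M -> M (const_mx 1) = 1%:M ->
  (forall t u, torus t -> torus u -> M (tmul t u) = M t *m M u) ->
  exists (S : seq 'rV[int]_r) (P : 'rV[int]_r -> 'M[C]_m),
    \sum_(a <- S) P a = 1%:M /\ forall a, a \in S -> forall t, torus t ->
      P a *m M t = char_eval a t *: P a /\ M t *m P a = char_eval a t *: P a.
Proof.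
move=> /laurent_uniq[S [P [uS MS]]] M1 MM; exists S, P; split.
  rewrite -M1 MS; last exact: torus1.
  by apply: eq_bigr => a _; rewrite char_eval1 scale1r.
(* Multiplicativity gives two expansions in [t] of M at the product of [t] and [u]; independence of
   characters equates their coefficients. *)
move=> a aS u tu; split; apply/eqP; rewrite -subr_eq0; apply/eqP.
- apply: (@char_independent _ S (fun a => P a *m M u - char_eval a u *: P a)) => // t tt.
  under eq_bigr do rewrite scalerBr scalemxAl scalerA -char_evalM.
  rewrite sumrB -mulmx_suml -MS// -MM// MS ?subrr//; exact: torusM.
- apply: (@char_independent _ S (fun a => M u *m P a - char_eval a u *: P a)) => // t tt.
  under eq_bigr do rewrite scalerBr scalemxAr scalerA mulrC -char_evalM.
  rewrite sumrB -mulmx_sumr -MS// -MM// MS ?subrr//; exact: torusM.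
Qed.

End TorusRepresentations.

(** * Fixed spaces of generic cocharacters *)

Section FixedSpaces.
Variables (R : realType) (n d r s : nat) (D : setup R n d r s).
Hypothesis hD : admissible D.
Local Notation C := (Cplx R).

Lemma laurent_tau i j : laurent (fun t => tau D t i j : C^o).
Proof.
have [[_ [[[tr _ _] _ _] _] _ _] _] := hD.
have [p /laurent_regular lp e] := tr i j.
exact: laurent_eq lp.
Qed.

Lemma tauV t : torus t -> tau D (tinv t) = invmx (tau D t).
Proof.
move=> tt; have [Gu _ _ _] := grpG_group hD; have ut := Gu _ (tau_grpG hD tt).
apply: (can_inj (mulmxK ut)); rewrite -tauM// ?tinvK ?tau1// ?mulVmx//.
exact: torusV.
Qed.

(** The inverse determinant of [tau D t] is the determinant of [tau D] at the inverse of [t]. *)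
Lemma laurent_regular_GL (p : 'M[C]_n -> C) :
  regular_GL p -> laurent (fun t => p (tau D t) : C^o).
Proof.
elim=> [q [->|[i [j ->]]]|z|p1 p2 _ l1 _ l2|p1 p2 _ l1 _ l2].
- apply: (@laurent_eq _ _ _ _ (fun t => \det (tau D (tinv t)) : C^o)).
    by move=> t tt; rewrite tauV// det_inv.
  apply: (laurent_inv (q := fun t => \det (tau D t) : C^o)).
  by apply: laurent_det; exact: laurent_tau.
- exact: laurent_tau.
- exact: laurent_cst.
- exact: laurentD.
- exact: laurentZ.
Qed.

Lemma laurent_rho : laurent (fun t => rho D (tau D t)).
Proof.
apply: laurent_mx => i j; have [[_ _ [rr _ _] _] _] := hD.
have [p /laurent_regular_GL lp e] := rr i j.
by apply: laurent_eq lp => t tt; apply: e; exact: tau_grpG.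
Qed.

Lemma pairing_dot (a l : 'rV[int]_r) :
  pairing (R := R) a (map_mx intr l) = (dot a l)%:~R.
Proof.
by rewrite /pairing rmorph_sum; apply: eq_bigr => j _; rewrite mxE rmorphM.
Qed.

(** Decompose [v] into weight components. A weight occurring in [v] vanishes on [lL]; if it is
    nonzero, its hyperplane contains [L] by genericity, hence [F], hence [lF]. *)
Lemma fixed_space_sub (F L : set 'rV[R]_r) (lF lL : 'rV[int]_r) :
  generic D F lF -> generic D L lL -> F `<=` L ->
  fixed_space D lL `<=` fixed_space D lF.
Proof.
move=> [Fx _] [_ genL] FL v vL z z0.
have [|t u tt tu|S [P [P1 PS]]] := torus_weight_decomposition laurent_rho.
- by rewrite tau1// rho1.
- by rewrite tauM// rhoM//; exact: tau_grpG.
have vS : v = \sum_(a <- S) P a *m v by rewrite -mulmx_suml P1 mul1mx.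
rewrite [in LHS]vS mulmx_sumr [RHS]vS big_seq [RHS]big_seq; apply: eq_bigr => a aS.
have two0 : (2 : C) != 0 by rewrite pnatr_eq0.
rewrite mulmxA ((PS a aS _ (torus_cochar _ z0)).2) -scalemxAl.
have [->|Pv0] := eqVneq (P a *m v) 0; first by rewrite scaler0.
suff aF : dot a lF = 0 by rewrite char_eval_cochar// aF expr0z scale1r.
(* Evaluation at z = 2 determines the exponent. *)
have aL : dot a lL = 0.
  have := congr1 (mulmx (P a)) (vL 2 two0).
  rewrite mulmxA ((PS a aS _ (torus_cochar _ two0)).1) -scalemxAl => /eqP.
  rewrite -[X in _ == X]scale1r -subr_eq0 -scalerBl scaler_eq0 (negPf Pv0) orbF.
  by rewrite subr_eq0 char_eval_cochar// -(expr0z 2) => /eqP/expr2z_inj.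
have [->|a0] := eqVneq a 0.
  by rewrite /dot big1// => j _; rewrite mxE mul0r.
have /genL LH : hyperplanes D [set x | pairing a x = 0].
  exists a; split=> //; left; exists (P a *m v) => // t tt.
  by rewrite mulmxA ((PS a aS _ tt).2) -scalemxAl.
have /LH/(_ _ (FL _ Fx)) : [set x | pairing a x = 0] (map_mx intr lL : 'rV[R]_r).
  by rewrite /= pairing_dot aL.
by rewrite /= pairing_dot => /eqP; rewrite intr_eq0 => /eqP.
Qed.

End FixedSpaces.
(** * The hyperplane arrangement *)

Section FiniteWeights.
Variable R : realType.
Local Notation C := (Cplx R).

(** Eigenvalues are roots of the characteristic polynomial of [f] acting on vectorized matrices. *)
Lemma finite_eigenvalues m p (f : {linear 'M[C]_(m, p) -> 'M[C]_(m, p)}) :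
  finite_set [set z : C | exists2 Z, Z != 0 & f Z = z *: Z].
Proof.
have [s ps] := closed_field_poly_normal (char_poly (lin_mx f)).
apply: (@sub_finite_set _ _ [set` s]); last exact: finite_seq.
move=> z [Z Z0 fZ] /=.
have : eigenvalue (lin_mx f) z.
  apply/eigenvalueP; exists (mxvec Z); last by rewrite mxvec_eq0.
  by rewrite mul_vec_lin fZ linearZ.
rewrite eigenvalue_root_char ps (monicP (char_poly_monic _)) scale1r.
by rewrite root_prod_XsubC.
Qed.

Lemma finite_rows (T : choiceType) (x0 : T) q (s : seq T) :
  finite_set [set a : 'rV[T]_q | forall j, a 0 j \in s].
Proof.
apply: (@sub_finite_set _ _
  ((fun f : {ffun 'I_q -> 'I_(size s)} => \row_j nth x0 s (f j)) @` setT)).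
  move=> a sa; have ia j : (index (a 0%R j) s < size s)%N by rewrite index_mem.
  exists [ffun j => Ordinal (ia j)] => //.
  by apply/rowP => j; rewrite !mxE ffunE /= nth_index//; exact: sa.
by apply: finite_image; exact: finite_finset.
Qed.

(* The point with j-th coordinate 2 and all others 1 reads off the j-th      *)
(* coordinate of a weight, as the eigenvalue 2 ^ (a 0 j).                    *)
Lemma finite_weights m p q (f : 'I_q -> {linear 'M[C]_(m, p) -> 'M[C]_(m, p)}) :
  finite_set [set a : 'rV[int]_q |
    exists2 Z, Z != 0 & forall j, f j Z = 2 ^ a 0 j *: Z].
Proof.
have fin j : finite_set [set e : int | exists2 Z, Z != 0 & f j Z = (2 : C) ^ e *: Z].
  apply: (@finite_preimage _ _ _ (fun e : int => (2 : C) ^ e) _ (finite_eigenvalues (f j))).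
  by move=> e e' _ _; exact: expr2z_inj.
have : finite_set (\bigcup_(j in [set: 'I_q])
    [set e : int | exists2 Z, Z != 0 & f j Z = (2 : C) ^ e *: Z]).
  by apply: bigcup_finite => //; exact: finite_finset.
move=> /finite_seqP[s sE]; apply: sub_finite_set (finite_rows 0 q s) => a [Z Z0 fZ] j.
suff : [set` s] (a 0 j) by [].
by rewrite -sE; exists j => //; exists Z.
Qed.

End FiniteWeights.

(** * Weights, flats and cells *)

Section Weights.
Variables (R : realType) (n d r s : nat) (D : setup R n d r s).
Local Notation C := (Cplx R).

Definition conj_lin (g : 'M[C]_n) : {linear 'M[C]_n -> 'M[C]_n} :=
  mulmxr (invmx g) \o mulmx g.

Lemma finite_T_weight : finite_set (T_weight D).
Proof.
have fV := finite_weights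
  (fun j : 'I_r => mulmx (rho D (tau D (coord_pt R j))) : {linear 'cV[C]_d -> 'cV[C]_d}).
have fg := finite_weights (fun j : 'I_r => conj_lin (tau D (coord_pt R j))).
apply: sub_finite_set (_ : finite_set (_ `|` _)); last first.
  by rewrite finite_setU; split; [exact: fV|exact: fg].
move=> a [[v v0 av]|[Z Z0 [_ aZ]]]; [left|right].
  by exists v => // j /=; rewrite av ?char_eval_coord_pt//; exact: torus_coord_pt.
by exists Z => // j /=; rewrite aZ ?char_eval_coord_pt//; exact: torus_coord_pt.
Qed.

Lemma dim_of_neq0 (vT : vectType C) (S : set vT) :
  dim_of S != 0%N -> exists2 v, v != 0 & S v.
Proof.
rewrite /dim_of => dS.
have : exists m : 'I_(dim vT).+1, (0 < m)%N &&
    `[< exists W : {vspace vT}, \dim W = m /\ forall w, w \in W -> S w >].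
  apply: contrapT => h; move/negP: dS; apply; rewrite -leqn0; apply/bigmax_leqP => m Sm.
  by rewrite leqNgt; apply/negP => m0; apply: h; exists m; rewrite m0.
move=> [m /andP[m0 /asboolP[W [dW WS]]]]; exists (vpick W).
  by rewrite vpick0 -dimv_eq0 dW -lt0n.
by apply: WS; exact: memv_pick.
Qed.

Lemma mult_V_neq0 al : mult_V D al != 0%N -> exists2 v, v != 0 & weight_V D al v.
Proof. exact: dim_of_neq0. Qed.

Lemma mult_g_neq0 al : mult_g D al != 0%N -> exists2 Z, Z != 0 & weight_g D al Z.
Proof. exact: dim_of_neq0. Qed.

Lemma mult_V_T_weight al : mult_V D al != 0%N -> T_weight D al.1.
Proof. by move=> /mult_V_neq0[v v0 [av _]]; left; exists v. Qed.

Lemma mult_g_T_weight al : mult_g D al != 0%N -> T_weight D al.1.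
Proof. by move=> /mult_g_neq0[Z Z0 [lZ aZ _]]; right; exists Z. Qed.

Lemma finite_mult_V : finite_set [set al | mult_V D al != 0%N].
Proof.
have fV := finite_weights
  (fun j : 'I_s => mulmx (rho' D (coord_pt R j)) : {linear 'cV[C]_d -> 'cV[C]_d}).
apply: sub_finite_set (finite_setX finite_T_weight fV) => al al0; split.
  exact: mult_V_T_weight.
have [v v0 [_ av]] := mult_V_neq0 al0; exists v => // j /=.
by rewrite av ?char_eval_coord_pt//; exact: torus_coord_pt.
Qed.

Lemma finite_mult_g : finite_set [set al | mult_g D al != 0%N].
Proof.
(* The torus T' acts trivially on the Lie algebra, so its weights are read from the identity map. *)
have fg := finite_weights (fun j : 'I_s => mulmx 1%:M : {linear 'M[C]_n -> 'M[C]_n}).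
apply: sub_finite_set (finite_setX finite_T_weight fg) => al al0; split.
  exact: mult_g_T_weight.
have [Z Z0 [_ _ aZ]] := mult_g_neq0 al0; exists Z => // j /=.
by rewrite mul1mx {1}(aZ _ (@torus_coord_pt R s j)) char_eval_coord_pt.
Qed.

Implicit Types (a : 'rV[int]_r) (x y : 'rV[R]_r) (A F : set 'rV[R]_r).

Lemma pairing_lin a (z : R) x y : pairing a (z *: x + y) = z * pairing a x + pairing a y.
Proof.
rewrite /pairing mulr_sumr -big_split /=; apply: eq_bigr => j _.
by rewrite !mxE; ring.
Qed.

Lemma pairing_continuous a : continuous (pairing a : 'rV[R]_r -> R).
Proof.
rewrite /pairing; apply: continuous_big => [y|j _ x]; first exact: add_continuous.
apply: (continuous_comp (f := fun y : 'rV[R]_r => y 0 j)); first exact: coord_continuous.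
exact: mulrl_continuous.
Qed.

Lemma pairing_closure_le0 a A : (forall x, A x -> pairing a x <= 0) ->
  forall x, closure A x -> pairing a x <= 0.
Proof.
move=> A0 x /(closure_subset A0).
apply: (@preimage_closed _ _ (pairing a) [set u | u <= 0]).
  by move=> y _; exact: pairing_continuous.
exact: closed_le.
Qed.

Lemma pairingN a x : pairing (- a) x = - pairing a x.
Proof. by rewrite -sumrN; apply: eq_bigr => j _; rewrite mxE rmorphN mulNr. Qed.

Lemma pairing_closure_ge0 a A : (forall x, A x -> 0 <= pairing a x) ->
  forall x, closure A x -> 0 <= pairing a x.
Proof.
move=> A0 x Ax; rewrite -oppr_le0 -pairingN.
by apply: pairing_closure_le0 Ax => y /A0; rewrite pairingN oppr_le0.
Qed.

Lemma pairing_closure_eq0 a A : (forall x, A x -> pairing a x = 0) ->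
  forall x, closure A x -> pairing a x = 0.
Proof.
move=> A0 x Ax; apply/eqP.
rewrite eq_le (pairing_closure_le0 _ Ax) ?(pairing_closure_ge0 _ Ax)//.
  by move=> y /A0->.
by move=> y /A0->.
Qed.

Lemma lspan_min A W : A `<=` W -> W 0 ->
  (forall (z : R) x y, W x -> W y -> W (z *: x + y)) -> lspan A `<=` W.
Proof. by move=> AW W0 WL x; apply. Qed.

Lemma sub_lspan A : A `<=` lspan A.
Proof. by move=> x Ax W [+ _ _]; apply. Qed.

Lemma hyperplanesP H : hyperplanes D H -> exists a,
  [/\ a != 0, T_weight D a & H = [set x | pairing a x = 0]].
Proof. by []. Qed.

Section Subspace.
Variable S : set (set 'rV[R]_r).
Hypothesis SH : S `<=` hyperplanes D.
Let L : set 'rV[R]_r := \bigcap_(H in S) H.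

Lemma flat_lin (z : R) x y : L x -> L y -> L (z *: x + y).
Proof.
move=> Lx Ly H SHH; have [a [_ _ HE]] := SH SHH.
have := Ly _ SHH; have := Lx _ SHH; rewrite HE /= => ax ay.
by rewrite pairing_lin ax ay mulr0 addr0.
Qed.

Lemma flat0 : L 0.
Proof.
by move=> H /SH[a [_ _ ->]] /=; rewrite /pairing big1// => j _; rewrite mxE mulr0.
Qed.

Lemma flat_closure A : A `<=` L -> closure A `<=` L.
Proof.
move=> AL x Ax H SHH; have [a [_ _ HE]] := SH SHH; rewrite HE /=.
by apply: pairing_closure_eq0 Ax => y /AL/(_ _ SHH); rewrite HE.
Qed.

Let M := L `\` \bigcup_(H in hyperplanes D `\` S) H.

(** Finitely many functionals that are nonzero at [x] stay nonzero on a short segment issuing from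
    [x]. *)
Lemma segment_avoid (t : seq 'rV[int]_r) x y : exists2 e : R, 0 < e &
  forall a, a \in t -> pairing a x != 0 ->
    forall u, 0 <= u <= e -> pairing a (u *: y + x) != 0.
Proof.
elim: t => [|b t [e e0 IH]]; first by exists 1.
have [bx|bx] := eqVneq (pairing b x) 0.
  exists e => // a; rewrite inE => /predU1P[->|]; first by rewrite bx eqxx.
  exact: IH.
(* For u between 0 and e', |u b(y)| < |b(x)|; adding 1 avoids a division by zero when b(y) = 0. *)
pose e' := `|pairing b x| / (`|pairing b y| + 1).
have y1 : 0 < `|pairing b y| + 1 by rewrite ltr_wpDl.
have e'0 : 0 < e' by rewrite divr_gt0 ?normr_gt0.
exists (Num.min e e'); first by rewrite lt_min e0.
move=> a; rewrite inE => /predU1P[->|/IH ha] ax u /andP[u0];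
  rewrite le_min => /andP[ue ue'].
  rewrite pairing_lin; apply/eqP => /eqP; rewrite addrC addr_eq0 => /eqP e1.
  have : `|pairing b x| < `|pairing b x|.
    rewrite {1}e1 normrN normrM (ger0_norm u0).
    apply: le_lt_trans (ler_wpM2r (normr_ge0 _) ue') _.
    rewrite /e' mulrAC ltr_pdivrMr// ltr_pM2l ?normr_gt0//.
    by rewrite ltrDl.
  by rewrite ltxx.
by apply: ha => //; rewrite u0.
Qed.

(* From x, the cell contains a segment in every direction y of the flat.     *)
Lemma lspan_component x : M x -> lspan (connected_component M x) = L.
Proof.
move=> Mx; apply/seteqP; split.
  apply: lspan_min; [|exact: flat0|exact: flat_lin].
  by move=> y /connected_component_sub[].
move=> y Ly W [CW W0 WL].
have [t tE] := (finite_seqP _).1 finite_T_weight.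
have [e e0 te] := segment_avoid t x y.
have seg u : 0 <= u <= e -> M (u *: y + x).
  move=> ue; split; first by apply: flat_lin => //; exact: Mx.1.
  (* A hyperplane outside [S] misses [x], so the segment avoids it. *)
  move=> [H [/hyperplanesP[a [a0 Ta HE]] nSH]]; rewrite HE /=; apply/eqP.
  apply: te => //; first by suff : [set` t] a by []; rewrite -tE.
  apply/eqP => ax; apply: Mx.2; exists H; last by rewrite HE.
  by split=> //; exists a.
have comp u : 0 <= u <= e -> connected_component M x (u *: y + x).
  move=> ue; apply: (@connected_component_max _ _
    ((fun u => u *: y + x) @` `[0, e]%classic)).
  - by exists 0; rewrite ?scale0r ?add0r//= in_itv /= lexx ltW.
  - by move=> _ [v + <-]; rewrite /= in_itv /= => /seg.
  - apply: connected_continuous_connected; first exact: segment_connected.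
    apply: continuous_subspaceT => v; apply: cvgD; last exact: cvg_cst.
    by apply: cvgZr_tmp; exact: cvg_id.
  - by exists u => //=; rewrite in_itv.
(* The direction [y] is a multiple of the difference of the endpoints of the segment, both of which
   lie in the cell. *)
have -> : y = e^-1 *: ((- 1) *: x + (e *: y + x)) + 0.
  by rewrite addr0 scaleN1r addrCA addNr addr0 scalerA mulVf ?scale1r// gt_eqF.
apply: (WL) => //; apply: (WL); apply: CW.
  by have := comp 0; rewrite scale0r add0r; apply; rewrite lexx ltW.
by apply: comp; rewrite lexx ltW.
Qed.

End Subspace.

Lemma cell_lspan_flat A : cell D A -> flat D (lspan A).
Proof. by move=> [S SH [x Mx ->]]; exists S; rewrite ?(lspan_component SH). Qed.

Lemma cell_nonempty A : cell D A -> A !=set0.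
Proof. by move=> [S SH [x Mx ->]]; exists x; exact: connected_component_refl. Qed.

Lemma cell_closure_lspan A : cell D A -> closure A `<=` lspan A.
Proof.
move=> [S SH [x Mx ->]]; rewrite lspan_component//; apply: flat_closure => //.
by move=> y /connected_component_sub[].
Qed.

Lemma prec_cell_lspan A A' : cell D A -> prec_cell A A' -> lspan A' `<=` lspan A.
Proof.
move=> cA AA'; apply: lspan_min.
- by move=> x /AA'; exact: (cell_closure_lspan cA).
- by move=> W [].
- by move=> z x y Ax Ay W hW; have [_ _ WL] := hW; apply: (WL); [exact: Ax|exact: Ay].
Qed.

Variant cell_sign_spec A a : Prop :=
| CellSign0 of (forall x, lspan A x -> pairing a x = 0)
| CellSignNeg of (forall x, A x -> pairing a x < 0)
| CellSignPos of (forall x, A x -> 0 < pairing a x).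

(** If the hyperplane of [a] is in [S], the weight vanishes on the span. Otherwise it has no zero on
    the cell, whose image is an interval by connectedness. *)
Lemma cell_sign A a : cell D A -> a != 0 -> T_weight D a -> cell_sign_spec A a.
Proof.
move=> [S SH [x Mx ->]] a0 Ta; pose H := [set y : 'rV[R]_r | pairing a y = 0].
have HH : hyperplanes D H by exists a.
have [SHH|nSHH] := pselect (S H).
  by apply: CellSign0 => y; rewrite lspan_component// => /(_ _ SHH).
set M := _ `\` _ in Mx *; set A' := connected_component M x.
have nz y : A' y -> pairing a y != 0.
  by move=> /connected_component_sub[_ h]; apply/eqP => ay; apply: h; exists H.
have : is_interval (pairing a @` A').
  apply/connected_intervalP/connected_continuous_connected.
    exact: component_connected.
  exact/continuous_subspaceT/pairing_continuous.
have Ax : A' x by exact: connected_component_refl.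
move=> itv; have := nz _ Ax; rewrite neq_lt => /orP[ax|ax].
  apply: CellSignNeg => y Ay; rewrite ltNge; apply/negP => ay.
  have [z Az az] : (pairing a @` A') 0.
    by apply: (itv (pairing a x) (pairing a y)); [exists x|exists y|rewrite ay ltW].
  by have := nz _ Az; rewrite az eqxx.
apply: CellSignPos => y Ay; rewrite ltNge; apply/negP => ay.
have [z Az az] : (pairing a @` A') 0.
  by apply: (itv (pairing a y) (pairing a x)); [exists y|exists x|rewrite ay ltW].
by have := nz _ Az; rewrite az eqxx.
Qed.

Lemma neg_on_neq0 A F (al : 'rV[int]_r * 'rV[int]_s) :
  A !=set0 -> neg_on A F al -> al.1 != 0.
Proof.
move=> [x Ax] [/(_ _ Ax) + _]; apply: contraTneq => ->.
by rewrite /pairing big1 ?ltxx// => j _; rewrite mxE mul0r.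
Qed.

Section Split.
Variables A A' F : set 'rV[R]_r.
Hypotheses (cA : cell D A) (cA' : cell D A') (AA' : prec_cell A A').
Hypothesis A'F : prec_flat A' F.
Implicit Type al : 'rV[int]_r * 'rV[int]_s.

Lemma neg_on_split al : T_weight D al.1 ->
  neg_on A F al <-> neg_on A (lspan A') al \/ neg_on A' F al.
Proof.
move=> Tal; have [x A'x] := cell_nonempty cA'.
have cx : closure A x by exact: AA'.
split=> [nA|[nA|nA']].
- have a0 := neg_on_neq0 (cell_nonempty cA) nA; case: nA => nA F0.
  have le0 := pairing_closure_le0 (fun y Ay => ltW (nA y Ay)).
  case: (cell_sign cA' a0 Tal) => [z|z|z]; [by left|by right|].
  (* [A'] lies in the closure of [A], where the weight is at most 0. *)
  by have := z _ A'x; rewrite ltNge le0.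
- by split; [exact: nA.1|move=> y /A'F; exact: nA.2].
- have a0 := neg_on_neq0 (cell_nonempty cA') nA'; split; last exact: nA'.2.
  (* The weight is negative at a point of the closure of [A], which is also in its span, so on [A]
     it is neither zero nor positive. *)
  have ax := nA'.1 _ A'x.
  case: (cell_sign cA a0 Tal) => [z|z|z]; [|by []|].
    by move: ax; rewrite (z _ (cell_closure_lspan cA cx)) ltxx.
  have := pairing_closure_ge0 (fun y Ay => ltW (z y Ay)) cx.
  by rewrite leNgt ax.
Qed.

Lemma neg_on_disjoint al : neg_on A (lspan A') al -> ~ neg_on A' F al.
Proof.
move=> [_ z] [ax _]; have [x A'x] := cell_nonempty cA'.
by have := ax _ A'x; rewrite z ?ltxx//; exact: sub_lspan.
Qed.

End Split.
End Weights.
(** * Localization and Euler classes *)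

Section LocalizationTheory.

Lemma iter_swap (T : Type) (f g : T -> T) : (forall x, f (g x) = g (f x)) ->
  forall p q x, iter p f (iter q g x) = iter q g (iter p f x).
Proof.
move=> fg p q x; elim: p => //= p ->; elim: q => //= q IHq; by rewrite fg IHq.
Qed.

Lemma frac_eqP (M : choiceType) (f : M -> M) x m y k :
  frac f x m = frac f y k <-> exists j, iter (j + k) f x = iter (j + m) f y.
Proof. by split=> [/eqmodP/asboolP//|h]; apply/eqmodP/asboolP. Qed.

Lemma loc_numK (M : choiceType) (f : M -> M) (q : loc f) :
  frac f (loc_num q) (loc_den q) = q.
Proof.
rewrite /frac /loc_num /loc_den -[RHS](reprK (q : {eq_quot loc_equiv f})).
by case: (repr _).
Qed.

(** The formal part of the theorem. In its application [i] is the pullback from <C'> to <C>, [g] is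
    the Euler class of the Lie algebra for C and <C'>, and [e1], [e2], [e12] are the Euler classes
    of V for (C, <C'>), (C', F) and (C, F), all acting over <C>; [e] is that for (C', F) acting over
    <C'>. The numerators and exponents of [q] and [y] are those of chosen representatives, known
    only up to equality of fractions. *)
Lemma frac_extension (M M' : choiceType) (i : M' -> M) (g e1 e2 e12 : M -> M)
    (e : M' -> M') (u0 : M') (q : loc e) (y : loc e1) :
  (forall x, e12 x = e1 (e2 x)) -> (forall x, e1 (e2 x) = e2 (e1 x)) ->
  (forall x, e1 (g x) = g (e1 x)) -> (forall x, e2 (g x) = g (e2 x)) ->
  (forall x, i (e x) = e2 (i x)) ->
  q = frac e u0 1 -> y = frac e1 (g (i (loc_num q))) 1 ->
  frac e12 (g (i u0)) 1 =
  frac e12 (iter (loc_den q) e1 (iter (loc_den y) e2 (loc_num y)))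
    (loc_den q + loc_den y).
Proof.
move=> e12E C12 C1g C2g ie.
rewrite -{1}(loc_numK q) -{1}(loc_numK y).
move: (loc_num q) (loc_den q) (loc_num y) (loc_den y) => u m w k.
(* [K] and [L] are the extra powers witnessing the two equalities of fractions; their sum serves for
   the conclusion. *)
move=> /frac_eqP[K /esym qK] /frac_eqP[L /esym yL]; apply/frac_eqP; exists (K + L)%N.
have C21 x : e2 (e1 x) = e1 (e2 x) by rewrite C12.
have e12N N x : iter N e12 x = iter N e1 (iter N e2 x).
  elim: N x => //= N IHN x; rewrite IHN e12E; congr (e1 _).
  exact: (iter_swap C21 1 N).
have iN N x : i (iter N e x) = iter N e2 (i x) by elim: N => //= N <-; rewrite ie.
have g2N N x : iter N e2 (g x) = g (iter N e2 x).
  exact: (iter_swap C2g N 1).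
rewrite !e12N.
(* Powers of [e2] become powers of [e] under [i], which allows [u0] to be exchanged for [u]. *)
have -> : iter (K + L + (m + k)) e2 (g (i u0)) = iter (L + k + (K + 1)) e2 (g (i u)).
  rewrite (_ : K + L + (m + k) = L + k + (K + m))%N; last by lia.
  by rewrite !(iterD (L + k)) !(g2N (K + _)%N) -!iN qK.
have -> : iter (K + L + 1) e1 (iter (K + L + 1) e2 (iter m e1 (iter k e2 w))) =
    iter (K + m) e1 (iter (K + L + 1 + k) e2 (iter (L + 1) e1 w)).
  rewrite (iter_swap C21 _ m) (iter_swap C21 _ (L + 1)) -!iterD.
  by congr (iter _ e1 _); lia.
rewrite -yL (iter_swap C21) -iterD.
by congr (iter _ e1 _); [lia|congr (iter _ e2 _); lia].
Qed.

End LocalizationTheory.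

Section EulerClasses.
Variables (R : realType) (n d r s : nat) (D : setup R n d r s).
Hypothesis hD : admissible D.
Local Notation weight := ('rV[int]_r * 'rV[int]_s)%type.
Local Notation BT := (BT D).

(** This covers the default value 0 of [chern1]. *)
Lemma degree2_0 : degree2 (0 : cohom BT).
Proof.
exists 0; first by split=> //; have [/asboolP] := @cocycles_zmod R BT.
rewrite /cls -(raddf0 (val : cocycle BT -> cochain BT)) valKd.
exact/esym/pi_zeror.
Qed.

Lemma degree2_chern1 (al : weight) : degree2 (chern1 D al).
Proof.
rewrite /chern1; case: xgetP => [h _ [c [-> c2 _ _]]|_]; last exact: degree2_0.
exists (val c); last by [].
by split=> //; case: c {c2} => c /= /asboolP.
Qed.

Lemma degree2_gen_euler_T mult A F : degree2_gen (euler_T D mult A F).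
Proof.
apply: degree2_gen_fsbig => //; first exact: BT_good.
move=> al; elim: (mult al) => [|m IHm] /=; first exact: Degree2_one.
by apply: Degree2_mul => //; exact: degree2_chern1.
Qed.

(** The partition of the weights is [neg_on_split]. A factor different from 1 comes from a nonzero
    multiplicity, so its weight is a [T_weight]. *)
Lemma euler_T_mul mult A A' F :
  finite_set [set al : weight | mult al != 0%N] ->
  (forall al : weight, mult al != 0%N -> T_weight D al.1) ->
  cell D A -> cell D A' -> prec_cell A A' -> prec_flat A' F ->
  euler_T D mult A F =
  cohom_mul (euler_T D mult A (lspan A')) (euler_T D mult A' F).
Proof.
move=> fin Tw cA cA' AA' A'F.
have n0 (al : weight) :
    iter (mult al) (cohom_mul (chern1 D al)) (cohom1 BT) != cohom1 BT ->
    mult al != 0%N by apply: contraNneq => ->.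
apply: degree2_fsbigU => //.
- exact: BT_good.
- move=> al; elim: (mult al) => [|m IHm] /=; first exact: Degree2_one.
  by apply: Degree2_mul => //; exact: degree2_chern1.
- by apply: sub_finite_set fin => al /= /n0.
- by move=> al /n0/Tw; exact: (neg_on_split cA cA' AA' A'F).
- by move=> al _; exact: (neg_on_disjoint cA').
Qed.

Variable lam : set 'rV[R]_r -> 'rV[int]_r.

(** Such classes commute when [to_BT] is injective, their images being products of classes of degree
    two. *)
Definition even_class l (x : cohom (BG D l)) := degree2_gen (to_BT D l x).

Lemma to_BT_mul l x y :
  to_BT D l (cohom_mul x y) = cohom_mul (to_BT D l x) (to_BT D l y).
Proof.
apply: (@pullback_mul R _ _ (@BTG_map R n d r s D l)) => //.
- exact: BTG_tower_map.
- exact: BT_good.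
- exact: BG_good.
Qed.

Lemma to_BT_BG l l' x : centralizer D l' `<=` centralizer D l ->
  to_BT D l' (to_BG l' x) = to_BT D l x.
Proof.
move=> h; apply: (@pullback_comp R _ _ _ (@BTG_map R n d r s D l')
  (@BGG_map R n d r s D l l') (@BTG_map R n d r s D l)) => //; try exact: flat_fct_map.
- exact: BTG_tower_map.
- exact: BGG_tower_map.
- by move=> N x'; exact: BTG_BGG.
Qed.

Lemma even_classC l x y : injective (to_BT D l) ->
  even_class x -> even_class y -> cohom_mul x y = cohom_mul y x :> cohom (BG D l).
Proof.
move=> inj ex ey; apply: inj; rewrite !to_BT_mul; apply: degree2_genC => //.
exact: BT_good.
Qed.

Lemma eu_act_mul F (a b : cohom (BG D (lam F))) (h : HF D lam F) :
  eu_act (cohom_mul a b) h = eu_act a (eu_act b h).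
Proof.
apply: (@coh_act_mul R _ _ (@fixedG_map R n d r s D (lam F))) => //.
- exact: fixedG_tower_map.
- exact: fixed_good.
- exact: BG_good.
Qed.

Lemma eu_actC F a b (h : HF D lam F) : injective (to_BT D (lam F)) ->
  even_class a -> even_class b -> eu_act a (eu_act b h) = eu_act b (eu_act a h).
Proof. by move=> inj ea eb; rewrite -!eu_act_mul (even_classC inj ea eb). Qed.

Section Restriction.
Variables F' F : set 'rV[R]_r.
Hypothesis cF : centralizer D (lam F') `<=` centralizer D (lam F).
Hypothesis vF : fixed_space D (lam F') `<=` fixed_space D (lam F).

Lemma istar_act a (h : HF D lam F) :
  istar F' (eu_act a h) = eu_act (to_BG (lam F') a) (istar F' h).
Proof.
apply: (@pullback_act R _ _ _ _ (@fixedG_map R n d r s D (lam F))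
  (@fixedG_map R n d r s D (lam F')) (@fixed_map R n d r s D (lam F) (lam F'))
  (@BGG_map R n d r s D (lam F) (lam F'))) => //.
- exact: fixedG_tower_map.
- exact: fixedG_tower_map.
- exact: fixed_tower_map.
- exact: BGG_tower_map.
- exact: fixed_fct_map.
- exact: fixed_good.
- exact: fixed_good.
- by move=> N x; exact: fixed_BGG.
Qed.

Lemma istar_comp F'' (h : HF D lam F) :
  centralizer D (lam F'') `<=` centralizer D (lam F') ->
  fixed_space D (lam F'') `<=` fixed_space D (lam F') ->
  istar F'' (istar F' h) = istar F'' h.
Proof.
move=> cF' vF'; apply: (@pullback_comp R _ _ _ (@fixed_map R n d r s D (lam F') (lam F''))
  (@fixed_map R n d r s D (lam F) (lam F')) (@fixed_map R n d r s D (lam F) (lam F''))).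
- exact: fixed_tower_map.
- exact: fixed_fct_map.
- exact: fixed_tower_map.
- exact: fixed_fct_map.
- by move=> N x; exact: fixed_map_comp.
Qed.

End Restriction.
End EulerClasses.

(** * Transitivity of restriction *)

Theorem proposition1p4 (R : realType) (n d r s : nat) (D : setup R n d r s)
    (lam : set 'rV[R]_r -> 'rV[int]_r)
    (hD : admissible D)
    (hlam : forall F, flat D F -> generic D F (lam F))
    (* G^F is contained in G^F' whenever F' is contained in F *)
    (hG : forall F F', flat D F -> flat D F' -> F' `<=` F ->
        centralizer D (lam F) `<=` centralizer D (lam F'))
    (* H^*_{G^F x T'}(pt) is contained in H^*_{T x T'}(pt) ... *)
    (hH : forall F, flat D F -> injective (to_BT D (lam F)))
    (* ... and the Euler classes belong to it *)
    (hEu : forall C F, cell D C -> flat D F -> prec_flat C F ->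
        (exists e, to_BT D (lam (lspan C)) e = euler_T D (mult_V D) C F) /\
        (exists e, to_BT D (lam (lspan C)) e = euler_T D (mult_g D) C F))
    (C C' F : set 'rV[R]_r)
    (hC : cell D C) (hC' : cell D C') (hF : flat D F)
    (hCC' : prec_cell C C') (hC'F : prec_flat C' F) :
  forall x : HF D lam F,
    Res C x = Res_ext C (Res C' x).
Proof.
move=> x; set L := lspan C; set L' := lspan C'.
have fL : flat D L by exact: cell_lspan_flat.
have fL' : flat D L' by exact: cell_lspan_flat.
have L'L : L' `<=` L by exact: (prec_cell_lspan hC hCC').
have FL' : F `<=` L' by exact: hC'F.
have cL' := hG _ _ fL fL' L'L; have cF := hG _ _ fL' hF FL'.
have vL' := fixed_space_sub hD (hlam _ fL') (hlam _ fL) L'L.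
have vF := fixed_space_sub hD (hlam _ hF) (hlam _ fL') FL'.
have injL := hH _ fL.
(* [hEu] provides a class for [xget] to choose, so [euler] has the expected image in the cohomology
   of BT. *)
have eulerV A E : cell D A -> flat D E -> prec_flat A E ->
    to_BT D (lam (lspan A)) (euler D lam (mult_V D) A E) = euler_T D (mult_V D) A E.
  by move=> cA fE AE; have [ex _] := hEu _ _ cA fE AE; exact: xgetPex ex.
have eulerg A E : cell D A -> flat D E -> prec_flat A E ->
    to_BT D (lam (lspan A)) (euler D lam (mult_g D) A E) = euler_T D (mult_g D) A E.
  by move=> cA fE AE; have [_ ex] := hEu _ _ cA fE AE; exact: xgetPex ex.
have CF : prec_flat C F by move=> y /FL'/L'L.
have toV : to_BT D (lam L) (to_BG (lam L) (euler D lam (mult_V D) C' F)) =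
    euler_T D (mult_V D) C' F.
  by rewrite to_BT_BG// eulerV.
have tog : to_BT D (lam L) (to_BG (lam L) (euler D lam (mult_g D) C' F)) =
    euler_T D (mult_g D) C' F.
  by rewrite to_BT_BG// eulerg.
(* The product formula in the cohomology of BT is lifted along the injection [to_BT]. *)
have mulV : euler D lam (mult_V D) C F = cohom_mul (euler D lam (mult_V D) C L')
    (to_BG (lam L) (euler D lam (mult_V D) C' F)).
  apply/injL/(etrans (eulerV C F hC hF CF)).
  rewrite (to_BT_mul hD) (eulerV C L' hC fL' L'L) toV.
  by apply: euler_T_mul => //; [exact: finite_mult_V|exact: mult_V_T_weight].
have mulg : euler D lam (mult_g D) C F = cohom_mul (euler D lam (mult_g D) C L')
    (to_BG (lam L) (euler D lam (mult_g D) C' F)).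
  apply/injL/(etrans (eulerg C F hC hF CF)).
  rewrite (to_BT_mul hD) (eulerg C L' hC fL' L'L) tog.
  by apply: euler_T_mul => //; [exact: finite_mult_g|exact: mult_g_T_weight].
have evV : even_class (to_BG (lam L) (euler D lam (mult_V D) C' F)).
  by rewrite /even_class toV; exact: degree2_gen_euler_T.
have evV' : even_class (euler D lam (mult_V D) C L').
  by rewrite /even_class eulerV//; exact: degree2_gen_euler_T.
have evg' : even_class (euler D lam (mult_g D) C L').
  by rewrite /even_class eulerg//; exact: degree2_gen_euler_T.
rewrite /Res_ext.
(* [u0] is the numerator of [Res C' x]; [resE] recovers from it the numerator of [Res C x]. *)
pose u0 := eu_act (euler D lam (mult_g D) C' F) (istar L' x).
have resE : eu_act (euler D lam (mult_g D) C F) (istar L x) =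
    eu_act (euler D lam (mult_g D) C L') (istar L u0).
  rewrite mulg (eu_act_mul hD) /u0 (istar_act hD cL' vL').
  by rewrite (istar_comp hD cF vF x cL' vL').
apply: (etrans (congr1 (fun h => frac (eu_act (euler D lam (mult_V D) C F)) h 1) resE)).
(* There remain the product formula for V, the commutation of Euler classes and the semilinearity of
   [istar]. *)
apply: (@frac_extension _ _ (@istar R n d r s D lam L L')
  (eu_act (euler D lam (mult_g D) C L')) (eu_act (euler D lam (mult_V D) C L'))
  (eu_act (to_BG (lam L) (euler D lam (mult_V D) C' F)))
  (eu_act (euler D lam (mult_V D) C F)) (eu_act (euler D lam (mult_V D) C' F))
  u0 (Res C' x) (Res C (loc_num (Res C' x)))).
- by move=> h; rewrite mulV (eu_act_mul hD).
- by move=> h; exact: (eu_actC hD h injL evV' evV).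
- by move=> h; exact: (eu_actC hD h injL evV' evg').
- by move=> h; exact: (eu_actC hD h injL evV evg').
- by move=> h; exact: (istar_act hD cL' vL').
- by [].
- by [].
Qed.
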